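(* Let $K\ge2$ and consider a $K$-armed stochastic bandit in which each arm distribution $\nu_a$ is a finitely supported probability distribution on $[0,1]$. Assume $\mu_a>0$ for all arms $a$ and $\mu^\star<1$. Run the empirical \texttt{KL-UCB} algorithm (described in the context) with $f(t)=\log(t)+\log(\log(t))$ for $t\ge2$. Then for every suboptimal arm $a$ (i.e. $\mu_a<\mu^\star$) there exists a constant $M(\nu_a,\mu^\star)>0$ depending only on $\nu_a$ and $\mu^\star$ such that, for all $T\ge3$, \[ \mathbb{E}[N_a(T)]\le \frac{\log(T)}{\mathcal{K}_{\inf}(\nu_a,\mu^\star)}+\frac{36}{(\mu^\star)^4}(\log T)^{4/5}\log(\log T)+\Big(\frac{72}{(\mu^\star)^4}+\frac{2\mu^\star}{(1-\mu^\star)\mathcal{K}_{\inf}(\nu_a,\mu^\star)^2}\Big)(\log T)^{4/5}+\frac{(1-\mu^\star)^2M(\nu_a,\mu^\star)}{2(\mu^\star)^2}(\log T)^{2/5}+\frac{\log(\log T)}{\mathcal{K}_{\inf}(\nu_a,\mu^\star)}+\frac{2\mu^\star}{(1-\mu^\star)\mathcal{K}_{\inf}(\nu_a,\mu^\star)^2}+4. \]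
   Context: Let $\mathcal{F}$ be the set of finitely supported probability distributions on $[0,1]$; $\mathrm{Supp}(\nu)$ is the finite support of $\nu\in\mathcal{F}$, $\mathbb{E}(\nu)$ its mean, $\mathrm{KL}$ the Kullback–Leibler divergence, and $\mathfrak{M}_1(S)$ the set of probability distributions on a set $S$. For $\nu\in\mathcal{F}$ and $\mu\in\mathbb{R}$, $\mathcal{K}_{\inf}(\nu,\mu)=\inf\{\mathrm{KL}(\nu,\nu'):\nu'\in\mathcal{F},\ \mathbb{E}(\nu')>\mu\}$. Bandit protocol: at each round $t\ge1$ the player picks an arm $A_t$ based on past information and receives a reward $Y_t$ drawn independently from $\nu_{A_t}$. $\mu_a=\mathbb{E}(\nu_a)$, $\mu^\star=\max_a\mu_a$, $N_a(t)=\sum_{s=1}^t\mathbf{1}\{A_s=a\}$, and $\hat\nu_a(t)=\frac{1}{N_a(t)}\sum_{s=1}^t\delta_{Y_s}\mathbf{1}\{A_s=a\}$ is the empirical distribution of arm $a$. Empirical \texttt{KL-UCB} algorithm with nondecreasing $f$: pull each arm once in rounds $1,\dots,K$; for $t=K,\dots,T-1$ compute for each arm $U_a(t)=\sup\{\mathbb{E}(\nu):\nu\in\mathfrak{M}_1(\mathrm{Supp}(\hat\nu_a(t))\cup\{1\}),\ \mathrm{KL}(\hat\nu_a(t),\nu)\le f(t)/N_a(t)\}$ and pull an arm $A_{t+1}\in\arg\max_aU_a(t)$. *)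

(* Defs.v *)
From HB Require Import structures.
From mathcomp Require Import all_boot all_order all_algebra.
From mathcomp Require Import all_classical all_reals all_analysis.
Set Implicit Arguments. Unset Strict Implicit. Unset Printing Implicit Defensive.
Import Order.TTheory GRing.Theory Num.Theory.
Local Open Scope classical_set_scope.
Local Open Scope ring_scope.

Section Bandit.
Variable R : realType.

(* A finitely supported distribution on the reals is represented by its
   probability mass function nu : R -> R. *)
Definition Supp (nu : R -> R) : set R := [set x | nu x != 0].

Definition is_fsdist (nu : R -> R) : Prop :=
  (forall x, 0 <= nu x) /\ finite_set (Supp nu) /\
  (Supp nu `<=` `[0, 1]) /\ \sum_(x \in Supp nu) nu x = 1.

Definition mean (nu : R -> R) : R := \sum_(x \in Supp nu) x * nu x.

Definition KL (nu nu' : R -> R) : \bar R :=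
  if pselect (Supp nu `<=` Supp nu')
  then (\sum_(x \in Supp nu) nu x * ln (nu x / nu' x))%:E
  else +oo%E.

Definition Kinf (nu : R -> R) (mu : R) : \bar R :=
  ereal_inf [set KL nu nu' | nu' in [set nu' | is_fsdist nu' /\ mu < mean nu']].

Definition UCB (nuh : R -> R) (c : R) : \bar R :=
  ereal_sup [set (mean nu')%:E | nu' in
    [set nu' | is_fsdist nu' /\ Supp nu' `<=` Supp nuh `|` [set 1] /\
               (KL nuh nu' <= c%:E)%E]].

Variable K : nat.

(* A history: the sequence of (arm pulled, reward received) pairs. *)
Definition Npulls (h : seq ('I_K * R)) (b : 'I_K) : nat :=
  count (fun p => p.1 == b) h.

Definition empdist (h : seq ('I_K * R)) (b : 'I_K) : R -> R :=
  fun x => (count (fun p => (p.1 == b) && (p.2 == x)) h)%:R / (Npulls h b)%:R.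

Definition f_klucb (t : R) : R := ln t + ln (ln t).

(* pol is (a deterministic, history-dependent tie-breaking of) the empirical
   KL-UCB algorithm with exploration function f: during the first K rounds
   each arm is pulled once; afterwards, at time t = size h, an arm maximizing
   U_b(t) is pulled. *)
Definition is_empirical_klucb (f : R -> R) (pol : seq ('I_K * R) -> 'I_K) : Prop :=
  forall h : seq ('I_K * R),
    ((size h < K)%N -> Npulls h (pol h) = 0%N) /\
    ((K <= size h)%N -> forall b : 'I_K,
       (UCB (empdist h b) (f (size h)%:R / (Npulls h b)%:R) <=
        UCB (empdist h (pol h)) (f (size h)%:R / (Npulls h (pol h))%:R))%E).

(* Expected number of pulls of arm a during the next n rounds, starting from
   history h, when the rewards of arm b are drawn independently from nu b. *)
Fixpoint expN (nu : 'I_K -> R -> R) (pol : seq ('I_K * R) -> 'I_K)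
    (a : 'I_K) (n : nat) (h : seq ('I_K * R)) : R :=
  match n with
  | 0 => 0
  | n'.+1 =>
    (pol h == a)%:R +
    \sum_(y \in Supp (nu (pol h))) nu (pol h) y * expN nu pol a n' (rcons h (pol h, y))
  end.

Definition ENpulls nu pol a (T : nat) : R := expN nu pol a T [::].

Definition mustar (nu : 'I_K -> R -> R) : R := \big[Num.max/0]_(b < K) mean (nu b).

End Bandit.

(* Main.v *)
(* Write [tilt l m x = 1 - l (x - m) / (1 - m)].  By convex duality
   [Kinf nu m] is the maximum over [l] in [0, 1] of the [nu]-expectation of
   [ln (tilt l m)].  Let [mu] be the best mean and [eps] be of order
   [(ln T)^(-1/5)].  If the suboptimal arm [a] is pulled at time [t], then
   either the index of an optimal arm is below [mu - eps] or that of [a] is at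
   least [mu - 2 eps].
   In the first case duality gives an [l] for which the product of
   [tilt l (mu - eps)] over the rewards of the optimal arm exceeds [t ln t].  By
   rounding, [l] may be taken in a grid of size [O(1 / eps^2)] once [mu - eps] is
   replaced by [mu]; for fixed [l] that product is a martingale of mean 1, so
   Markov's inequality bounds the probability by [O(1 / (eps^2 t ln t))], whose
   sum over [t < T] is [O(ln ln T / eps^2)].
   In the second case the sum of [ln (tilt l (mu - 2 eps))] over the rewards of
   [a], for the [l] that is optimal for [nu_a] at level [mu + eps], is at most
   [f T].  This is a random walk of drift at least [Kinf - O(eps)], and
   Chernoff's bound limits the expected number of its visits below [f T] to
   [f T / (Kinf - O(eps)) + O(1 / eps)].
   Altogether the number of pulls is [f T / Kinf + O((ln T)^(4/5))] with a
   constant depending only on [nu_a] and [mu]; the remainder is dominated by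
   [36 / mu^4 (ln T)^(4/5) ln (ln T)] for large [T], and for the other [T] by
   the term in [(ln T)^(2/5)], as [M] is at our disposal. *)

Require Import Defs.
From HB Require Import structures.
From mathcomp Require Import all_boot all_order all_algebra.
From mathcomp Require Import all_classical all_reals all_analysis.
From mathcomp Require Import ring lra.
Set Implicit Arguments. Unset Strict Implicit. Unset Printing Implicit Defensive.
Import Order.TTheory GRing.Theory Num.Theory.
Import numFieldNormedType.Exports.
Local Open Scope classical_set_scope.
Local Open Scope ring_scope.

(** * Elementary inequalities *)

Lemma expR_le_inv (R : realType) (x : R) : x < 1 -> expR x <= (1 - x)^-1.
Proof.
move=> x1; rewrite -[x in expR x]opprK expRN lef_pV2 ?posrE ?expR_gt0 ?subr_gt0//.
exact: expR_ge1Dx.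
Qed.

(** By [expR x <= (1 - x)^-1] at [x = 1 / 6], the number [e] is at most [(6 / 5) ^ 6 = 2.985984]. *)
Lemma ln3_ge1 (R : realType) : 1 <= ln 3 :> R.
Proof.
suff e3 : expR 1 <= 3 :> R by rewrite -[leLHS]expRK ler_ln ?posrE ?expR_gt0.
have -> : 1 = (1 / 6) * 6%:R :> R by field.
rewrite expRM_natr.
have : expR (1 / 6) <= 6 / 5 :> R.
  apply: le_trans (expR_le_inv _) _; first lra.
  by have -> // : (1 - 1 / 6)^-1 = 6 / 5 :> R by field.
have := expR_ge0 (1 / 6 : R).
move: (expR _) => e e0 e1.
have : e ^+ 6 <= (6 / 5) ^+ 6 by apply: lerXn2r; rewrite ?nnegrE//; lra.
by move=> /le_trans; apply; lra.
Qed.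

Lemma expR_le_quad (R : realType) (u : R) : `|u| <= 1 / 2 ->
  expR u <= 1 + u + 2 * u ^+ 2.
Proof.
rewrite ler_norml => /andP[u1 u2].
apply: le_trans (expR_le_inv _) _; first lra.
rewrite -[leLHS]mul1r ler_pdivrMr; last lra.
by have := sqr_ge0 u; rewrite expr2; nra.
Qed.

Lemma ln_le_subr1 (R : realType) (x : R) : 0 < x -> ln x <= x - 1.
Proof.
move=> x0; rewrite -{1}(subrKC 1 x); apply: le_ln1Dx; lra.
Qed.

Lemma ln_ge_quad (R : realType) (u : R) : - (1 / 2) <= u ->
  u - 2 * u ^+ 2 <= ln (1 + u).
Proof.
move=> hu; have u1 : 0 < 1 + u by lra.
have := @ln_le_subr1 R (1 + u)^-1; rewrite invr_gt0 lnV ?posrE// => /(_ u1) h.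
have : (1 + u)^-1 <= 1 - u + 2 * u ^+ 2.
  rewrite -[leLHS]mul1r ler_pdivrMr//.
  by have := sqr_ge0 u; rewrite expr2; nra.
lra.
Qed.

(** * Duality for Kinf *)

(* The factor [1 - l (x - m) / (1 - m)], as a convex combination. *)
Definition tilt (R : realType) (l m x : R) : R := 1 - l + l * ((1 - x) / (1 - m)).

Lemma tiltE (R : realType) (l m x : R) : m < 1 ->
  tilt l m x = 1 + l * ((m - x) / (1 - m)).
Proof. by move=> m1; rewrite /tilt; field; lra. Qed.

Lemma tilt_ge0 (R : realType) (l m x : R) : m < 1 -> 0 <= l <= 1 -> x <= 1 ->
  0 <= tilt l m x.
Proof.
move=> m1 l1 x1; rewrite /tilt.
have : 0 <= (1 - x) / (1 - m) by apply: divr_ge0; lra.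
nra.
Qed.

Lemma tilt_le (R : realType) (l m x : R) : 0 <= m < 1 -> 0 <= l <= 1 ->
  0 <= x -> tilt l m x <= (1 - m)^-1.
Proof.
move=> m1 l1 x0; rewrite /tilt -[leRHS]mul1r ler_pdivlMr; last lra.
have -> : (1 - l + l * ((1 - x) / (1 - m))) * (1 - m) = (1 - l) * (1 - m) + l * (1 - x).
  by field; lra.
nra.
Qed.

(** The factor carries the part proportional to [l] exactly to its counterpart at [m] and, being at
    most 1, only shrinks [1 - l]. An [l] chosen at one mean thus serves at a smaller one, up to a
    constant factor. *)
Lemma tilt_monom (R : realType) (l m m' x : R) : m <= m' -> m' < 1 ->
  0 <= l <= 1 -> x <= 1 ->
  (1 - m') / (1 - m) * tilt l m' x <= tilt l m x.
Proof.
move=> mm' m1 l1 x1; rewrite /tilt mulrDr mulrCA lerD//.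
  rewrite ler_piMl; [by []|lra|]; rewrite ler_pdivrMr; lra.
rewrite ler_wpM2l; [by []|lra|].
by rewrite le_eqVlt; apply/orP; left; apply/eqP; field; lra.
Qed.

(* Optimality conditions for the maximisation over [l] in [0, 1] of the concave
   function [\sum p x * ln (1 + l * a x)], obtained from a zero of its
   derivative rather than from a maximiser. *)
Lemma dual_critical_point (R : realType) (s : seq R) (p a : R -> R) (A : R) :
  uniq s -> (forall x, x \in s -> 0 < p x) -> \sum_(x <- s) p x = 1 ->
  (forall x, x \in s -> -1 <= a x <= A) ->
  exists l, [/\ 0 <= l <= 1, forall x, x \in s -> 0 < 1 + l * a x,
    0 <= l * \sum_(x <- s) p x * a x / (1 + l * a x) &
    (1 - l) * \sum_(x <- s) p x * a x / (1 + l * a x) <= 0].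
Proof.
move=> us p0 p1 aA; set phi := fun l => \sum_(x <- s) p x * a x / (1 + l * a x).
have [phi0|phi0] := leP (phi 0) 0.
  exists 0; split; [lra| |by rewrite mul0r|by rewrite subr0 mul1r].
  by move=> x _; rewrite mul0r addr0.
(* No denominator vanishes on [[0, l1]], so the intermediate value theorem yields a zero of [phi]
   unless an endpoint already satisfies the conditions. *)
suff [l1 [l10 l11 pos phil1]] : exists l1, [/\ 0 <= l1, l1 <= 1,
    forall l x, 0 <= l <= l1 -> x \in s -> 0 < 1 + l * a x & phi l1 <= 0 \/ l1 = 1].
  have [h|h] := leP 0 (phi l1).
    have [h'|l1E] := phil1.
      have e : phi l1 = 0 by apply/eqP; rewrite eq_le h'.
      exists l1; split; [lra| |by rewrite -/(phi _) e mulr0|by rewrite -/(phi _) e mulr0].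
      by move=> x xs; apply: pos => //; lra.
    exists l1; rewrite -/(phi l1); split; [lra| |nra|by rewrite l1E subrr mul0r].
    by move=> x xs; apply: pos => //; lra.
  have cphi : {within `[0, l1], continuous phi}.
    apply: continuous_in_subspaceT => l; rewrite inE /= in_itv /= => ll.
    rewrite /phi.
    have : forall x, x \in s -> 0 < 1 + l * a x by move=> x; exact: pos.
    elim: (s) => [|y t IH] post.
      have -> : (fun l => \sum_(x <- [::]) p x * a x / (1 + l * a x)) = cst 0.
        by apply/funext => z; rewrite big_nil.
      exact: cvg_cst.
    have -> : (fun l => \sum_(x <- y :: t) p x * a x / (1 + l * a x)) =
       (fun l => p y * a y / (1 + l * a y)) \+ (fun l => \sum_(x <- t) p x * a x / (1 + l * a x)).
      by apply/funext => z; rewrite big_cons.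
    apply: cvgD; last by apply: IH => x xt; apply: post; rewrite inE xt orbT.
    apply: cvgM; first exact: cvg_cst.
    apply: cvgV; first by rewrite gt_eqF// post// inE eqxx.
    apply: cvgD; first exact: cvg_cst.
    by apply: cvgM; [exact: cvg_id|exact: cvg_cst].
  have [|l] := @IVT R phi 0 l1 0 l10 cphi.
    by rewrite ge_min le_max (ltW h) (ltW phi0) orbT.
  rewrite in_itv /= => ll phil.
  exists l; rewrite -/(phi l) phil; split; [lra| |by rewrite mulr0|by rewrite mulr0].
  by move=> x xs; apply: pos.
(* At an atom with [a z = -1] the denominator vanishes for [l = 1]. Stopping [p z / (A + 2)] short
   of 1 makes the term of [z] equal to [- (A + 2)], which outweighs all the others. *)
have [[z zs az]|noz] := pselect (exists2 z, z \in s & a z = -1).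
  have A1 : -1 <= A by have := aA z zs; lra.
  have pz := p0 z zs.
  have pz1 : p z <= 1.
    rewrite -p1 (bigD1_seq z)//= lerDl big_seq_cond sumr_ge0// => x /andP[xs _].
    exact/ltW/p0.
  have B0 : 0 < A + 2 by lra.
  have q1 : p z / (A + 2) <= 1 by rewrite ler_pdivrMr//; lra.
  have q0 : 0 < p z / (A + 2) by rewrite divr_gt0.
  exists (1 - p z / (A + 2)); split; [lra|lra| |left].
    by move=> l x ll xs; have := aA _ xs; nra.
  rewrite /phi (bigD1_seq z)//= az.
  have -> : p z * -1 / (1 + (1 - p z / (A + 2)) * -1) = - (A + 2) by field; lra.
  suff : \sum_(i <- s | i != z) p i * a i / (1 + (1 - p z / (A + 2)) * a i) <= A + 2 by lra.
  apply: (@le_trans _ _ (\sum_(i <- s | i != z) p i * (A + 2))).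
    rewrite big_seq_cond [leRHS]big_seq_cond; apply: ler_sum => x /andP[xs _].
    rewrite -mulrA ler_wpM2l//; first exact/ltW/p0.
    have := aA _ xs => ax.
    have W0 : 0 < 1 + (1 - p z / (A + 2)) * a x by nra.
    rewrite ler_pdivrMr//; have [ax0|/ltW ax0] := leP 0 (a x); last first.
      by apply: le_trans ax0 _; apply: mulr_ge0; [lra|exact: ltW].
    have : 1 <= 1 + (1 - p z / (A + 2)) * a x by rewrite lerDl mulr_ge0//; lra.
    nra.
  rewrite -mulr_suml -[leRHS]mul1r ler_wpM2r//; first lra.
  rewrite -p1 [leRHS](bigD1_seq z)//=; lra.
exists 1; split; [lra|lra| |by right].
move=> l x ll xs; have := aA _ xs => ax.
have : a x != -1 by apply/eqP => e; apply: noz; exists x.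
rewrite neq_lt => /orP[|ax1]; first lra.
have [a0|a0] := leP 0 (a x); first nra.
apply: (@lt_le_trans _ _ (1 + a x)); [lra|nra].
Qed.

Lemma Supp_sum (R : realType) (s : seq R) (nu F : R -> R) : uniq s ->
  (forall x, nu x != 0 -> x \in s) -> (forall x, nu x = 0 -> F x = 0) ->
  \sum_(x \in Supp nu) F x = \sum_(x <- s) F x.
Proof.
move=> us snu F0; rewrite (@fsbig_fwiden _ _ _ _ s)//.
move=> x [_] /= h; apply: F0; apply/eqP; move: h.
by rewrite /Supp /= => /negP; rewrite negbK.
Qed.

Lemma fsdist_seq (R : realType) (nu : R -> R) : is_fsdist nu ->
  exists s, [/\ uniq s, forall x, (x \in s) = (nu x != 0),
    forall x, x \in s -> 0 <= x <= 1 & \sum_(x <- s) nu x = 1].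
Proof.
move=> [nu0 [/finite_seqP[s0 sE] [sub sum1]]].
have inS x : (x \in undup s0) = (nu x != 0).
  rewrite mem_undup; apply/idP/idP => h; first by have : Supp nu x by rewrite sE.
  by have : [set` s0] x by rewrite -sE.
exists (undup s0); split => //; first exact: undup_uniq.
- by move=> x; rewrite inS => /sub; rewrite /= in_itv.
- rewrite -sum1 (@Supp_sum _ (undup s0))// ?undup_uniq// => x.
  by rewrite inS.
Qed.

Lemma is_fsdist_seq (R : realType) (s : seq R) (nu : R -> R) : uniq s ->
  (forall x, nu x != 0 -> x \in s) -> (forall x, x \in s -> 0 <= x <= 1) ->
  (forall x, 0 <= nu x) -> \sum_(x <- s) nu x = 1 -> is_fsdist nu.
Proof.
move=> us snu s01 nu0 sum1; split=> //; split; last split.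
- by apply: (sub_finite_set _ (finite_seq s)) => x /snu.
- by move=> x /snu /s01; rewrite /= in_itv.
- by rewrite (Supp_sum us snu).
Qed.

Lemma mean_seq (R : realType) (s : seq R) (nu : R -> R) : uniq s ->
  (forall x, nu x != 0 -> x \in s) -> mean nu = \sum_(x <- s) x * nu x.
Proof. by move=> us snu; apply: Supp_sum => // x ->; rewrite mulr0. Qed.

(** The witness is [nu] divided by the tilt, with the missing mass [l * phi] placed at 1.
    Criticality of [l] makes its mean at least [m]. Missing mass forces [l = 1], where the tilt
    vanishes at 1; so 1 is then no atom of [nu] and the divergence ignores the added mass. *)
Lemma duality_attained (R : realType) (nu : R -> R) (m : R) :
  is_fsdist nu -> 0 <= m < 1 ->
  exists l nu', [/\ 0 <= l <= 1, forall x, nu x != 0 -> 0 < tilt l m x,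
    is_fsdist nu' /\ Supp nu' `<=` Supp nu `|` [set 1], m <= mean nu' &
    KL nu nu' = (\sum_(x \in Supp nu) nu x * ln (tilt l m x))%:E].
Proof.
move=> dnu m01; have m1 : 0 < 1 - m by lra.
have [s [us snu s01 sum1]] := fsdist_seq dnu.
have nu0 := dnu.1.
pose a x := (m - x) / (1 - m).
have [||l [l01 W0 D0 D1]] := @dual_critical_point R s nu a (1 - m)^-1 us _ sum1.
- by move=> x; rewrite snu lt_def nu0 andbT.
- by move=> x /s01 x01; rewrite /a ler_pdivlMr// -[X in _ && (_ <= X)]mul1r ler_pM2r ?invr_gt0//; lra.
set phi := \sum_(x <- s) nu x * a x / (1 + l * a x) in D0 D1.
have tE x : tilt l m x = 1 + l * a x by rewrite tiltE//; lra.
have W0' x : nu x != 0 -> 0 < tilt l m x by rewrite -snu tE; exact: W0.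
pose nu' x := nu x / tilt l m x + (x == 1)%:R * (l * phi).
have nu'0 x : 0 <= nu' x.
  apply: addr_ge0; last by rewrite mulr_ge0 ?ler0n.
  have [->|/W0'/ltW W] := eqVneq (nu x) 0.
    by rewrite mul0r.
  by rewrite divr_ge0.
pose s1 := undup (1 :: s).
have us1 : uniq s1 by rewrite undup_uniq.
have ss1 x : x \in s -> x \in s1 by rewrite mem_undup inE => ->; rewrite orbT.
have s1s (F : R -> R) : (forall x, nu x = 0 -> F x = 0) ->
    \sum_(x <- s1) F x = \sum_(x <- s) F x.
  move=> F0; rewrite -(@Supp_sum _ s1 nu)//; last by move=> x; rewrite -snu; exact: ss1.
  by rewrite (@Supp_sum _ s nu)// => x; rewrite snu.
have s1D (F : R -> R) (c : R) : \sum_(x <- s1) F x * ((x == 1)%:R * c) = F 1 * c.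
  rewrite (bigD1_seq 1)//= ?mem_undup ?inE ?eqxx// mul1r big1 ?addr0// => x /negPf ->.
  by rewrite mul0r mulr0.
have sW : \sum_(x <- s) nu x / tilt l m x = 1 - l * phi.
  rewrite -sum1 /phi mulr_sumr -sumrB; apply: eq_big_seq => x xs.
  by rewrite tE; field; rewrite gt_eqF// W0.
have supp' x : nu' x != 0 -> x \in s1.
  rewrite mem_undup inE snu; have [//|x1 /=] := eqVneq x 1.
  by rewrite /nu' (negPf x1) mul0r addr0; apply: contra => /eqP ->; rewrite mul0r.
have sum1' : \sum_(x <- s1) nu' x = 1.
  rewrite big_split /= s1s; last by move=> x ->; rewrite mul0r.
  rewrite sW; under eq_bigr do rewrite -[_ * (l * phi)]mul1r.
  by rewrite s1D; ring.
have D1' : l * phi != 0 -> nu 1 = 0.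
  move=> lphi; apply/eqP; apply/negPn/negP; rewrite -snu => /W0.
  have -> : a 1 = -1 by rewrite /a; field; lra.
  have phi0 : 0 < phi.
    have : 0 < l * phi by rewrite lt_def lphi.
    by case/andP: l01 => l0 _ h; rewrite ltNge; apply/negP => ?; nra.
  have : l < 1 -> False by nra.
  lra.
exists l, nu'; split => //.
- split.
    apply: (is_fsdist_seq us1) => // x; rewrite mem_undup inE => /orP[/eqP ->|]; [lra|exact: s01].
  move=> x; rewrite /Supp /= => /supp'; rewrite mem_undup inE snu => /orP[/eqP|]; by [right|left].
- rewrite (mean_seq us1 supp').
  under eq_bigr do rewrite mulrDr.
  rewrite big_split /= (s1D id) s1s; last by move=> x ->; rewrite mul0r mulr0.
  have -> : \sum_(x <- s) x * (nu x / tilt l m x) = m * (1 - l * phi) - (1 - m) * phi.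
    rewrite -sW mulr_sumr /phi mulr_sumr -sumrB; apply: eq_big_seq => x xs.
    have xE : x = m - (1 - m) * a x by rewrite /a; field; lra.
    by rewrite tE {1}xE; field; rewrite gt_eqF// W0.
  have : 0 <= (1 - m) * ((1 - l) * - phi) by apply: mulr_ge0; [lra|rewrite mulrN oppr_ge0].
  lra.
- rewrite /KL; case: (pselect (Supp nu `<=` Supp nu')) => [?|]; last first.
    case=> x nx; rewrite /Supp /= /nu' gt_eqF// ltr_pwDl//.
      by rewrite divr_gt0 ?W0'// lt_def nx nu0.
    by rewrite mulr_ge0.
  congr (_%:E); rewrite !(@Supp_sum _ s)//; try by move=> x; rewrite snu.
  - apply: eq_big_seq => x xs; have := xs; rewrite snu => nx; congr (_ * ln _).
    rewrite /nu'; have -> : (x == 1)%:R * (l * phi) = 0.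
      have [x1|] := eqVneq x 1; last by rewrite mul0r.
      have [->|/D1'] := eqVneq (l * phi) 0; first by rewrite mulr0.
      by move=> n1; move: nx; rewrite x1 n1 eqxx.
    by rewrite addr0; field; rewrite nx gt_eqF// W0'.
  - by move=> x ->; rewrite mul0r.
  - by move=> x ->; rewrite mul0r.
Qed.

(** Apply [ln y <= y - 1] to [y = tilt l m x * nu' x / nu x]. The error terms sum to at most 0,
    because the affine function [tilt l m] has [nu']-mean at most 1 once [mean nu'] reaches [m]. *)
Lemma weak_duality (R : realType) (nu nu' : R -> R) (l m : R) :
  is_fsdist nu -> is_fsdist nu' -> m < 1 -> 0 <= l <= 1 -> m <= mean nu' ->
  (forall x, nu x != 0 -> 0 < tilt l m x) ->
  ((\sum_(x \in Supp nu) nu x * ln (tilt l m x))%:E <= KL nu nu')%E.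
Proof.
move=> dnu dnu' m1 l01 mm W0.
rewrite /KL; case: (pselect (Supp nu `<=` Supp nu')) => [sub|?]; last by rewrite leey.
have [s [us snu s01 sum1]] := fsdist_seq dnu.
have [s' [us' snu' s01' sum1']] := fsdist_seq dnu'.
have nu0 := dnu.1; have nu0' := dnu'.1.
rewrite lee_fin !(@Supp_sum _ s)//; try by [move=> x ->; rewrite mul0r|move=> x; rewrite snu].
have pos x : x \in s -> 0 < nu x /\ 0 < nu' x.
  by rewrite snu => nx; rewrite !lt_def nu0 nu0' nx !andbT; split => //; exact: sub.
have term x : x \in s -> nu x * ln (tilt l m x) <=
    nu x * ln (nu x / nu' x) + (nu' x * tilt l m x - nu x).
  move=> xs; have [n0 n0'] := pos _ xs.
  have W := W0 x (lt0r_neq0 n0).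
  have := @ln_le_subr1 R (tilt l m x / (nu x / nu' x)).
  rewrite ln_div ?posrE ?divr_gt0// => /(_ isT).
  rewrite -(ler_pM2l n0) => h.
  have -> : nu' x * tilt l m x - nu x = nu x * (tilt l m x / (nu x / nu' x) - 1).
    by field; rewrite !gt_eqF.
  lra.
apply: le_trans (_ : \sum_(x <- s) (nu x * ln (nu x / nu' x) + (nu' x * tilt l m x - nu x)) <= _).
  by rewrite big_seq [leRHS]big_seq; apply: ler_sum.
rewrite big_split /= sumrB sum1 gerDl subr_le0.
(* Extension by zero moves the sum to the support of [nu']; the terms then added are nonnegative. *)
pose G x := if x \in s then nu' x * tilt l m x else 0.
have -> : \sum_(x <- s) nu' x * tilt l m x = \sum_(x <- s') G x.
  rewrite -(@Supp_sum _ s' nu)//.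
  - rewrite (@Supp_sum _ s)//; [|by move=> x; rewrite snu|].
      by apply: eq_big_seq => x xs; rewrite /G xs.
    by move=> x nx; rewrite /G snu nx eqxx.
  - by move=> x nx; rewrite snu'; apply: sub.
  - by move=> x nx; rewrite /G snu nx eqxx.
apply: (@le_trans _ _ (\sum_(x <- s') nu' x * tilt l m x)).
  rewrite big_seq [leRHS]big_seq; apply: ler_sum => x xs; rewrite /G; case: ifP => // _.
  by rewrite mulr_ge0// tilt_ge0//; have := s01' _ xs; lra.
have -> : \sum_(x <- s') nu' x * tilt l m x = 1 - l * ((mean nu' - m) / (1 - m)).
  rewrite (mean_seq us'); last by move=> x; rewrite snu'.
  rewrite -{1}sum1'.
  have -> : \sum_(x <- s') x * nu' x - m = \sum_(x <- s') (x - m) * nu' x.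
    by rewrite -{1}[m]mulr1 -sum1' mulr_sumr -sumrB; apply: eq_bigr => x _; ring.
  rewrite mulr_suml mulr_sumr -sumrB; apply: eq_bigr => x _.
  by rewrite tiltE//; field; lra.
by rewrite gerBl mulr_ge0 ?divr_ge0//; lra.
Qed.

(** * Empirical distributions and upper confidence bounds *)

Definition rewards (R : realType) (K : nat) (h : seq ('I_K * R)) (b : 'I_K) : seq R :=
  [seq p.2 | p <- h & p.1 == b].

Lemma size_rewards (R : realType) (K : nat) (h : seq ('I_K * R)) b :
  size (rewards h b) = Npulls h b.
Proof. by rewrite size_map size_filter. Qed.

Lemma empdistE (R : realType) (K : nat) (h : seq ('I_K * R)) b x :
  empdist h b x = (count_mem x (rewards h b))%:R / (Npulls h b)%:R.
Proof.
rewrite /empdist /rewards count_map count_filter; congr (_%:R / _).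
by apply: eq_count => p /=; rewrite andbC.
Qed.

Lemma empdist_supp (R : realType) (K : nat) (h : seq ('I_K * R)) b x :
  empdist h b x != 0 -> x \in rewards h b.
Proof.
rewrite empdistE -has_pred1 has_count lt0n; apply: contra => /eqP ->.
by rewrite mul0r.
Qed.

Lemma empdist_sum (R : realType) (K : nat) (h : seq ('I_K * R)) b (F : R -> R) :
  \sum_(x <- undup (rewards h b)) empdist h b x * F x =
  (\sum_(x <- rewards h b) F x) / (Npulls h b)%:R.
Proof.
rewrite mulr_suml.
under eq_bigr do rewrite empdistE mulrAC.
rewrite -!mulr_suml; congr (_ / _).
rewrite -[RHS]big_undup_iterop_count; apply: eq_bigr => x _.
by rewrite Monoid.iteropE mulr_natl; elim: (count_mem x _) => //= n IH; rewrite mulrS IH.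
Qed.

Lemma empdist_fsdist (R : realType) (K : nat) (h : seq ('I_K * R)) b :
  (0 < Npulls h b)%N -> {in rewards h b, forall x, 0 <= x <= 1} ->
  is_fsdist (empdist h b).
Proof.
move=> N0 h01; apply: (@is_fsdist_seq _ (undup (rewards h b))).
- exact: undup_uniq.
- by move=> x /empdist_supp; rewrite mem_undup.
- by move=> x; rewrite mem_undup; exact: h01.
- by move=> x; rewrite divr_ge0.
- have := empdist_sum h b (cst 1); rewrite /cst big_const_seq count_predT iter_addr addr0 size_rewards.
  under eq_bigr do rewrite mulr1.
  by move=> ->; rewrite mulfV// pnatr_eq0 -lt0n.
Qed.

Lemma empdist_Supp_sum (R : realType) (K : nat) (h : seq ('I_K * R)) b (F : R -> R) :
  \sum_(x \in Supp (empdist h b)) empdist h b x * F x =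
  (\sum_(x <- rewards h b) F x) / (Npulls h b)%:R.
Proof.
rewrite -empdist_sum; apply: Supp_sum; first exact: undup_uniq.
- by move=> x /empdist_supp; rewrite mem_undup.
- by move=> x ->; rewrite mul0r.
Qed.

(** The witness of [duality_attained] has as divergence the average log-tilt for one particular [l],
    so a bound over all [l] makes it a competitor in the supremum. *)
Lemma le_UCB (R : realType) (K : nat) (h : seq ('I_K * R)) b (m f : R) :
  0 <= f -> 0 <= m < 1 -> {in rewards h b, forall x, 0 <= x <= 1} ->
  (forall l, 0 <= l <= 1 -> {in rewards h b, forall x, 0 < tilt l m x} ->
    \sum_(x <- rewards h b) ln (tilt l m x) <= f) ->
  (m%:E <= UCB (empdist h b) (f / (Npulls h b)%:R))%E.
Proof.
move=> f0 m01 h01 hl.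
(* For an unpulled arm division by 0 gives 0: the empirical distribution and the radius vanish, the
   divergence is an empty sum, and the point mass at 1 is a competitor. *)
have [N0|N0] := posnP (Npulls h b).
  have r0 : rewards h b = [::] by apply: size0nil; rewrite size_rewards.
  have e0 x : empdist h b x = 0.
    by apply/eqP/negPn/negP => /empdist_supp; rewrite r0.
  pose d (x : R) : R := (x == 1)%:R.
  have d1 x : d x != 0 -> x \in [:: 1].
    by rewrite /d inE; case: (x == 1); rewrite ?mulr0n ?eqxx.
  apply: (@le_trans _ _ (mean d)%:E).
    by rewrite (@mean_seq _ [:: 1])// big_seq1 /d eqxx mul1r mulr1n lee_fin; lra.
  apply: ereal_sup_ubound; exists d => //; split; [|split].
  - apply: (@is_fsdist_seq _ [:: 1]) => //.
    + by move=> x; rewrite inE => /eqP ->; lra.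
    + by rewrite big_seq1 /d eqxx mulr1n.
  - by move=> x /d1; rewrite inE => /eqP ->; right.
  - rewrite /KL; case: (pselect (Supp (empdist h b) `<=` Supp d)) => [?|]; last first.
      by case=> x; rewrite /Supp /= e0 eqxx.
    rewrite (@Supp_sum _ [::])//= ?big_nil ?N0 ?invr0 ?mulr0//.
      by move=> x; rewrite e0 eqxx.
    by move=> x ->; rewrite mul0r.
have demp := empdist_fsdist N0 h01.
have [l [nu' [l01 W0 [dnu' sub] mnu' KLE]]] := duality_attained demp m01.
apply: (@le_trans _ _ (mean nu')%:E); first by rewrite lee_fin.
apply: ereal_sup_ubound; exists nu' => //; split=> //; split=> //.
rewrite KLE empdist_Supp_sum lee_fin ler_pM2r ?invr_gt0 ?ltr0n//.
apply: hl => // x xr; apply: W0.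
rewrite empdistE mulf_neq0// ?invr_eq0 pnatr_eq0 -lt0n//.
by rewrite -has_count has_pred1.
Qed.

(** By weak duality, a competitor of mean above [m] would have divergence at least the average
    log-tilt, which exceeds the radius. *)
Lemma UCB_le (R : realType) (K : nat) (h : seq ('I_K * R)) b (l m f : R) :
  0 <= f -> m < 1 -> 0 <= l <= 1 -> {in rewards h b, forall x, 0 <= x <= 1} ->
  {in rewards h b, forall x, 0 < tilt l m x} ->
  f < \sum_(x <- rewards h b) ln (tilt l m x) ->
  (UCB (empdist h b) (f / (Npulls h b)%:R) <= m%:E)%E.
Proof.
move=> f0 m1 l01 h01 W0 fS.
have N0 : (0 < Npulls h b)%N.
  rewrite lt0n -size_rewards size_eq0; apply: contraTneq fS => ->.
  by rewrite big_nil -leNgt.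
apply: ge_ereal_sup => _ [nu' [dnu' [sub KLle]] <-]; rewrite lee_fin leNgt; apply/negP => mm.
have := @weak_duality R (empdist h b) nu' l m (empdist_fsdist N0 h01) dnu' m1 l01 (ltW mm).
move=> /(_ (fun x nx => W0 x (empdist_supp nx))) /le_trans /(_ KLle).
by rewrite empdist_Supp_sum lee_fin ler_pM2r ?invr_gt0 ?ltr0n// leNgt fS.
Qed.

(** The head is the [l] at which [tilt l mu x] is [1 + eps / 2 * (mu - x)]; it replaces parameters
    too small to be rounded down. *)
Definition tilt_grid (R : realType) (mu eps : R) (n : nat) : seq R :=
  eps * (1 - mu) / 2 :: [seq i%:R / n%:R | i <- iota 0 n.+1].

(* The slack [eps] between the two means pays for rounding [l] down to a grid
   point, unless [l] is so small that the first grid point beats it outright. *)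
Lemma tilt_grid_dominates (R : realType) (mu eps l : R) (n : nat) (xs : seq R) :
  0 < eps <= 1 -> 0 <= mu - eps -> mu < 1 -> 0 <= l <= 1 ->
  2 / (eps ^+ 2 * (1 - mu)) <= n%:R ->
  {in xs, forall x, 0 <= x <= 1} -> {in xs, forall x, 0 < tilt l (mu - eps) x} ->
  0 < \sum_(x <- xs) ln (tilt l (mu - eps) x) ->
  exists2 l', l' \in tilt_grid mu eps n & {in xs, forall x, 0 < tilt l' mu x} /\
    \sum_(x <- xs) ln (tilt l (mu - eps) x) <= \sum_(x <- xs) ln (tilt l' mu x).
Proof.
move=> eps01 m0 mu1 l01 hn xs01 W0 S0.
have d0 : 0 < eps ^+ 2 * (1 - mu) by rewrite mulr_gt0 ?exprn_gt0//; lra.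
have n0 : 0 < n%:R :> R by apply: lt_le_trans hn; rewrite divr_gt0.
(* For small [l] the log-sum is at most [eps / 2 * A]. The head point earns at least as much: its
   quadratic loss per reward is at most [2 * (eps / 2) ^ 2], which is the slack [eps / 2 * eps]
   contained in [A]. *)
have [lsmall|lbig] := leP l (eps * (1 - mu) / 2).
  exists (eps * (1 - mu) / 2); first by rewrite inE eqxx.
  have tE x : tilt (eps * (1 - mu) / 2) mu x = 1 + eps / 2 * (mu - x).
    by rewrite tiltE//; field; lra.
  split; first by move=> x /xs01 x01; rewrite tE; nra.
  set A := \sum_(x <- xs) (mu - eps - x).
  have SA : \sum_(x <- xs) ln (tilt l (mu - eps) x) <= l / (1 - (mu - eps)) * A.
    rewrite /A mulr_sumr big_seq [leRHS]big_seq; apply: ler_sum => x xxs.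
    apply: le_trans (ln_le_subr1 (W0 _ xxs)) _; rewrite tiltE; last lra.
    by rewrite le_eqVlt; apply/orP; left; apply/eqP; field; lra.
  have A0 : 0 < A.
    have : 0 <= l / (1 - (mu - eps)) by apply: divr_ge0; lra.
    move: (l / _) SA => c SA c0; rewrite ltNge; apply/negP => A0; nra.
  apply: le_trans SA _; apply: (@le_trans _ _ (eps / 2 * A)).
    by rewrite ler_pM2r// ler_pdivrMr; [nra|lra].
  rewrite /A mulr_sumr big_seq [leRHS]big_seq; apply: ler_sum => x xxs.
  have x01 := xs01 _ xxs; rewrite tE.
  apply: le_trans (ln_ge_quad _); [have : (mu - x) ^+ 2 <= 1; [|by move=> h; nra]|nra].
  by rewrite expr2; nra.
set i := Num.truncn (l * n%:R).
have [i1 i2] : i%:R <= l * n%:R /\ l * n%:R < i.+1%:R.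
  by apply/andP; apply: truncn_itv; apply: mulr_ge0; lra.
have iE : i%:R = i%:R / n%:R * n%:R :> R by rewrite divfK ?gt_eqF.
exists (i%:R / n%:R).
  rewrite in_cons; apply/orP; right; apply: (map_f (fun j => j%:R / n%:R)); rewrite mem_iota add0n ltnS /=.
  by rewrite -(ler_nat R); apply: le_trans i1 _; rewrite ler_piMl; [| |lra].
have l'0 : 0 <= i%:R / n%:R :> R by rewrite divr_ge0.
rewrite -natr1 in i2; rewrite iE in i1 i2.
move: i1 i2 l'0; move: (i%:R / n%:R) => l' i1 i2 l'0.
have l'l : l' <= l by rewrite -(ler_pM2r n0).
have nd : 1 <= n%:R * (eps ^+ 2 * (1 - mu) / 2).
  by move: hn; rewrite ler_pdivrMr//; lra.
have ll' : l - l' <= eps ^+ 2 * (1 - mu) / 2.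
  have : (l - l') * n%:R <= n%:R * (eps ^+ 2 * (1 - mu) / 2) by lra.
  by rewrite mulrC ler_pM2l.
have tt x : 0 <= x <= 1 -> tilt l (mu - eps) x <= tilt l' mu x.
  move=> x01.
  (* The difference of the two tilts is affine in [x]: [key] gives its sign at 0, and at 1 it equals
     [l - l']. *)
  have key : 0 <= l' * mu / (1 - mu) - l * (mu - eps) / (1 - (mu - eps)).
    have -> : l' * mu / (1 - mu) - l * (mu - eps) / (1 - (mu - eps)) =
      (l * eps - (l - l') * (mu * (1 - (mu - eps)))) / ((1 - mu) * (1 - (mu - eps))).
      by field; lra.
    apply: divr_ge0; last by apply: mulr_ge0; lra.
    have : (l - l') * (mu * (1 - (mu - eps))) <= eps ^+ 2 * (1 - mu) / 2.
      apply: le_trans ll'; rewrite ler_piMr; [by []|lra|nra].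
    have : eps * (eps * (1 - mu) / 2) <= eps * l by rewrite ler_pM2l; lra.
    lra.
  rewrite -subr_ge0 /tilt.
  have -> : 1 - l' + l' * ((1 - x) / (1 - mu)) - (1 - l + l * ((1 - x) / (1 - (mu - eps)))) =
    x * (l - l') + (1 - x) * (l' * mu / (1 - mu) - l * (mu - eps) / (1 - (mu - eps))).
    by field; lra.
  by apply: addr_ge0; apply: mulr_ge0; lra.
split; first by move=> x xxs; apply: lt_le_trans (W0 _ xxs) (tt _ (xs01 _ xxs)).
rewrite big_seq [leRHS]big_seq; apply: ler_sum => x xxs.
rewrite ler_ln ?posrE ?W0 ?tt ?xs01//.
by apply: lt_le_trans (W0 _ xxs) (tt _ (xs01 _ xxs)).
Qed.

(** * Potentials for the expected number of pulls *)

Lemma rewards_rcons (R : realType) (K : nat) (h : seq ('I_K * R)) (b c : 'I_K) (y : R) :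
  rewards (rcons h (c, y)) b =
  if c == b then rcons (rewards h b) y else rewards h b.
Proof. by rewrite /rewards filter_rcons /=; case: ifP; rewrite ?map_rcons. Qed.

(** A policy is defined on all histories, but only those whose rewards are atoms of the pulled arms
    can occur; on these all rewards lie in [[0, 1]]. *)
Definition plausible (R : realType) (K : nat) (nu : 'I_K -> R -> R)
  (h : seq ('I_K * R)) : Prop := {in h, forall p, nu p.1 p.2 != 0}.

Lemma plausible_rewards (R : realType) (K : nat) (nu : 'I_K -> R -> R) h b x :
  plausible nu h -> x \in rewards h b -> nu b x != 0.
Proof.
by move=> ph /mapP[p]; rewrite mem_filter => /andP[/eqP <- /ph] h0 ->.
Qed.

Lemma expN_le_potential (R : realType) (K : nat) (nu : 'I_K -> R -> R) pol a
    (T : nat) (Phi : seq ('I_K * R) -> R) :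
  (forall b, is_fsdist (nu b)) ->
  (forall h, plausible nu h -> 0 <= Phi h) ->
  (forall h, plausible nu h -> (size h < T)%N -> (pol h == a)%:R +
    \sum_(y \in Supp (nu (pol h))) nu (pol h) y * Phi (rcons h (pol h, y)) <= Phi h) ->
  forall n h, plausible nu h -> (size h + n <= T)%N -> expN nu pol a n h <= Phi h.
Proof.
move=> dnu Phi0 step; elim=> [|n IH] h ph hT; first exact: Phi0.
have hT' : (size h < T)%N by move: hT; rewrite addnS; apply: leq_ltn_trans; rewrite leq_addr.
apply: le_trans (step h ph hT'); rewrite /= lerD2l.
have [s [us snu s01 sum1]] := fsdist_seq (dnu (pol h)).
have sumE (F : R -> R) : \sum_(y \in Supp (nu (pol h))) nu (pol h) y * F y =
    \sum_(y <- s) nu (pol h) y * F y.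
  by apply: Supp_sum => // [x|x ->]; rewrite ?snu ?mul0r.
rewrite !sumE big_seq [leRHS]big_seq; apply: ler_sum => y ys.
apply: ler_wpM2l; first exact: (dnu _).1.
apply: IH; last by rewrite size_rcons addSnnS.
move=> p; rewrite mem_rcons inE => /orP[/eqP -> /=|/ph//]; by rewrite -snu.
Qed.

(** Total capital of bettors against the mean [mu], one for each [l] in the grid, each starting with
    capital 1. *)
Definition mixture_wealth (R : realType) (g : seq R) (mu : R) (xs : seq R) : R :=
  \sum_(l <- g) \prod_(x <- xs) tilt l mu x.

(** A tilt at the mean of [nu] is affine with value 1 there, so its expectation is 1. *)
Lemma mixture_wealth_martingale (R : realType) (nu : R -> R) (s g xs : seq R) :
  is_fsdist nu -> uniq s -> (forall x, (x \in s) = (nu x != 0)) -> mean nu < 1 ->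
  \sum_(y <- s) nu y * mixture_wealth g (mean nu) (rcons xs y) =
  mixture_wealth g (mean nu) xs.
Proof.
move=> dnu us snu m1; rewrite /mixture_wealth.
have sum1 : \sum_(y <- s) nu y = 1.
  by have [_ [_ [_ <-]]] := dnu; rewrite (Supp_sum us)// => x; rewrite snu.
under eq_bigr do rewrite mulr_sumr.
rewrite exchange_big /=; apply: eq_bigr => l _.
under eq_bigr do rewrite big_rcons /= mulrCA.
rewrite -mulr_sumr -[RHS]mulr1; congr (_ * _).
under eq_bigr do rewrite tiltE// mulrDr mulr1.
rewrite big_split /= sum1 -[RHS]addr0; congr (_ + _).
have -> : \sum_(y <- s) nu y * (l * ((mean nu - y) / (1 - mean nu))) =
    l / (1 - mean nu) * \sum_(y <- s) (mean nu * nu y - y * nu y).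
  by rewrite mulr_sumr; apply: eq_bigr => y _; field; lra.
rewrite sumrB -mulr_sumr sum1 -(@mean_seq _ s)//; last by move=> x; rewrite snu.
by rewrite mulr1 subrr mulr0.
Qed.

(* An upper bound on the expected number of further visits of the random walk
   with steps [V] to the half-line below [F], [n0 - n] steps of which are
   conceded, the later ones being bounded by Chernoff's method. *)
Definition chernoff_potential (R : realType) (V : R -> R) (F theta rho : R)
    (n0 : nat) (xs : seq R) : R :=
  (n0 - size xs)%:R +
  expR (theta * (F - \sum_(x <- xs) V x)) * rho ^+ (n0 - size xs) / (1 - rho).

(** During the first [n0] steps the counter pays for a visit, and one factor [rho] offsets the
    exponential moment. Afterwards [e / (1 - rho) = e + e / (1 - rho) * rho], where [e] is at least
    1 while the walk is below [F]. *)
Lemma chernoff_potential_step (R : realType) (nu : R -> R) (V : R -> R)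
    (F theta rho : R) (n0 : nat) (s xs : seq R) :
  0 <= rho < 1 -> 0 <= theta -> (forall x, 0 <= nu x) -> \sum_(y <- s) nu y = 1 ->
  \sum_(y <- s) nu y * expR (- (theta * V y)) <= rho ->
  (\sum_(x <- xs) V x <= F)%R%:R +
    \sum_(y <- s) nu y * chernoff_potential V F theta rho n0 (rcons xs y) <=
  chernoff_potential V F theta rho n0 xs.
Proof.
move=> rho01 th0 nu0 sum1 mgf; rewrite /chernoff_potential.
set S := \sum_(x <- xs) V x; set e := expR (theta * (F - S)).
have e0 : 0 <= e by exact: expR_ge0.
have r0 : 0 <= (1 - rho)^-1 by rewrite invr_ge0; lra.
have lhsE : \sum_(y <- s) nu y * ((n0 - size (rcons xs y))%:R +
     expR (theta * (F - \sum_(x <- rcons xs y) V x)) * rho ^+ (n0 - size (rcons xs y)) /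
     (1 - rho)) = (n0 - (size xs).+1)%:R + e * rho ^+ (n0 - (size xs).+1) / (1 - rho) *
     \sum_(y <- s) nu y * expR (- (theta * V y)).
  rewrite -[X in _ = X + _]mulr1 -sum1 !mulr_sumr -big_split /=; apply: eq_bigr => y _.
  rewrite size_rcons big_rcons /= -/S.
  have -> : theta * (F - (S + V y)) = theta * (F - S) + - (theta * V y) by ring.
  by rewrite expRD -/e; ring.
rewrite lhsE.
have [n0N|Nn0] := ltnP (size xs) n0; last first.
  have -> : (n0 - size xs)%N = 0%N by apply/eqP; rewrite subn_eq0.
  have -> : (n0 - (size xs).+1)%N = 0%N by apply/eqP; rewrite subn_eq0 ltnW.
  rewrite expr0 mulr1 !add0r.
  have ind : (S <= F)%R%:R <= e.
    case: (leP S F) => SF /=; last exact: e0.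
    rewrite mulr1n; apply: le_trans (expR_ge1Dx _); rewrite lerDl mulr_ge0// subr_ge0//.
  have : e / (1 - rho) * \sum_(y <- s) nu y * expR (- (theta * V y)) <= e / (1 - rho) * rho.
    by apply: ler_wpM2l => //; exact: mulr_ge0.
  have : e / (1 - rho) = e + e / (1 - rho) * rho by field; lra.
  lra.
have -> : (n0 - size xs)%N = (n0 - (size xs).+1).+1 by rewrite subnS prednK// subn_gt0.
move: (n0 - _)%N => k.
have : e * rho ^+ k / (1 - rho) * \sum_(y <- s) nu y * expR (- (theta * V y)) <=
    e * rho ^+ k / (1 - rho) * rho.
  by apply: ler_wpM2l => //; rewrite !mulr_ge0// exprn_ge0//; case/andP: rho01.
have : (S <= F)%R%:R <= 1 :> R by case: (S <= F)%R.
have -> : e * rho ^+ k.+1 / (1 - rho) = e * rho ^+ k / (1 - rho) * rho by rewrite exprSr; ring.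
rewrite -natr1; lra.
Qed.

(** The potential is [D h + Z h * w (size h)]. A pull with the walk below [F] is paid by the drop of
    [D]. Any other is paid by the drop [1 / (t * ln t)] of [w] at [t = size h], multiplied by the
    martingale [Z], which is then at least [t * ln t]. This is Markov's inequality summed over time;
    [Z] starts at [size g]. *)
Lemma ENpulls_le (R : realType) (K : nat) (nu : 'I_K -> R -> R) pol (a b : 'I_K)
    (T n0 : nat) (g : seq R) (V : R -> R) (F theta rho : R) :
  (forall c, is_fsdist (nu c)) -> mean (nu b) < 1 ->
  {in g, forall l, 0 <= l <= 1} -> 0 <= rho < 1 -> 0 <= theta ->
  \sum_(y \in Supp (nu a)) nu a y * expR (- (theta * V y)) <= rho ->
  (forall h, plausible nu h -> (size h < T)%N -> pol h = a ->
    F < \sum_(x <- rewards h a) V x -> (2 <= size h)%N /\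
    (size h)%:R * ln (size h)%:R <= mixture_wealth g (mean (nu b)) (rewards h b)) ->
  ENpulls nu pol a T <= n0%:R + expR (theta * F) * rho ^+ n0 / (1 - rho) +
    (size g)%:R * \sum_(0 <= i < T | (2 <= i)%N) (i%:R * ln i%:R)^-1.
Proof.
move=> dnu mb1 g01 rho01 th0 mgf cover.
pose w t : R := \sum_(t <= i < T | (2 <= i)%N) (i%:R * ln i%:R)^-1.
pose Z h := mixture_wealth g (mean (nu b)) (rewards h b).
pose D h := chernoff_potential V F theta rho n0 (rewards h a).
have Z0 h : plausible nu h -> 0 <= Z h.
  move=> ph; rewrite /Z /mixture_wealth big_seq; apply: sumr_ge0 => l lg.
  rewrite big_seq; apply: prodr_ge0 => x xr; apply: tilt_ge0; rewrite ?g01//.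
  have [s [_ snu s01 _]] := fsdist_seq (dnu b).
  have := plausible_rewards ph xr; rewrite -snu => /s01; lra.
have iln0 i : (2 <= i)%N -> 0 <= (i%:R * ln i%:R)^-1 :> R.
  by move=> i2; rewrite invr_ge0 mulr_ge0// ln_ge0// ler1n ltnW.
have w0 t : 0 <= w t by apply: sumr_ge0 => i; exact: iln0.
have D0 h : 0 <= D h.
  rewrite /D /chernoff_potential addr_ge0// !mulr_ge0 ?expR_ge0 ?exprn_ge0 ?invr_ge0//; lra.
have -> : n0%:R + expR (theta * F) * rho ^+ n0 / (1 - rho) +
    (size g)%:R * \sum_(0 <= i < T | (2 <= i)%N) (i%:R * ln i%:R)^-1 = D [::] + Z [::] * w 0%N.
  rewrite /D /Z /chernoff_potential /mixture_wealth /rewards /= subn0 big_nil subr0.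
  by congr (_ + _ * _); under eq_bigr do rewrite big_nil; rewrite big_const_seq count_predT iter_addr addr0.
apply: (@expN_le_potential _ _ _ _ _ T (fun h => D h + Z h * w (size h))) => //.
  by move=> h ph; rewrite addr_ge0// mulr_ge0// Z0.
move=> h ph hT.
have [s [us snu s01 sum1]] := fsdist_seq (dnu (pol h)).
rewrite (@Supp_sum _ s)//; last 2 first.
- by move=> x; rewrite snu.
- by move=> x ->; rewrite mul0r.
under eq_bigr do rewrite size_rcons mulrDr mulrA.
rewrite big_split /= -mulr_suml.
have -> : \sum_(y <- s) nu (pol h) y * Z (rcons h (pol h, y)) = Z h.
  have [e|ne] := eqVneq (pol h) b.
    rewrite /Z; under eq_bigr do rewrite rewards_rcons e eqxx.
    by rewrite -e in mb1 *; exact: mixture_wealth_martingale.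
  rewrite /Z; under eq_bigr do rewrite rewards_rcons (negPf ne).
  by rewrite -mulr_suml sum1 mul1r.
have wE : w (size h) = (if (2 <= size h)%N then ((size h)%:R * ln (size h)%:R)^-1 else 0) + w (size h).+1.
  by rewrite /w big_ltn_cond//; case: ifP; rewrite ?add0r.
have Zw : Z h * w (size h).+1 <= Z h * w (size h).
  by rewrite ler_wpM2l ?Z0// wE lerDr; case: ifP => // /iln0.
have [e|ne] := eqVneq (pol h) a; last first.
  rewrite mulr0n add0r /D; under eq_bigr do rewrite rewards_rcons (negPf ne).
  by rewrite -mulr_suml sum1 mul1r lerD2l.
have := @chernoff_potential_step R (nu (pol h)) V F theta rho n0 s (rewards h a)
  rho01 th0 (dnu _).1 sum1.
rewrite {1}e -(@Supp_sum _ s (nu a)); last 3 first.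
- exact: us.
- by move=> x; rewrite snu e.
- by move=> x ->; rewrite mul0r.
move=> /(_ mgf) stepD.
under eq_bigr do rewrite /D rewards_rcons e eqxx.
move: stepD; rewrite -/(D h) e.
case: (leP _ F) => [_|SF] /=; rewrite ?mulr0n ?mulr1n; first by lra.
have [h2 hZ] := cover _ ph hT e SF.
have : 1 <= Z h * ((size h)%:R * ln (size h)%:R)^-1.
  rewrite ler_pdivlMr ?mul1r// mulr_gt0 ?ltr0n ?ln_gt0 ?ltr1n//; exact: leq_trans h2.
rewrite wE h2 mulrDr; lra.
Qed.

(** * Exponential moments of the suboptimal arm *)

(** With [d = mu - mean nu], weak duality for the tilt [1 + d / 4 * (mu - x)] gives the lower bound
    [d ^ 2 / 8]. Finiteness comes from the dual witness at [(mu + 1) / 2], whose mean exceeds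
    [mu]. *)
Lemma Kinf_fin_gt0 (R : realType) (nu : R -> R) (mu : R) :
  is_fsdist nu -> mean nu < mu -> 0 <= mu < 1 ->
  exists2 k, Kinf nu mu = k%:E & 0 < k.
Proof.
move=> dnu mmu mu01; have [s [us snu s01 sum1]] := fsdist_seq dnu.
have nu0 := dnu.1.
have m0 : 0 <= mean nu.
  rewrite (@mean_seq _ s)//; last by move=> x; rewrite snu.
  by rewrite big_seq; apply: sumr_ge0 => x /s01 x01; rewrite mulr_ge0//; lra.
set d := mu - mean nu; have d01 : 0 < d <= 1 by rewrite /d; lra.
have tE x : tilt (d / 4 * (1 - mu)) mu x = 1 + d / 4 * (mu - x).
  by rewrite tiltE; [field; lra|lra].
have lb : ((d ^+ 2 / 8)%:E <= Kinf nu mu)%E.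
  apply: le_ereal_inf_tmp => _ [nu' [dnu' mnu'] <-].
  apply: (@le_trans _ _ (\sum_(x \in Supp nu) nu x * ln (tilt (d / 4 * (1 - mu)) mu x))%:E);
    last first.
    apply: weak_duality => //; [lra|by apply/andP; split; nra|lra|].
    by move=> x; rewrite -snu => /s01 x01; rewrite tE; nra.
  rewrite lee_fin (@Supp_sum _ s)//; last 2 first.
  - by move=> x; rewrite snu.
  - by move=> x ->; rewrite mul0r.
  apply: (@le_trans _ _ (\sum_(x <- s) nu x * (d / 4 * (mu - x) - 2 * (d / 4) ^+ 2))).
    have -> : \sum_(x <- s) nu x * (d / 4 * (mu - x) - 2 * (d / 4) ^+ 2) =
      \sum_(x <- s) ((d / 4 * mu - 2 * (d / 4) ^+ 2) * nu x - d / 4 * (x * nu x)).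
      by apply: eq_bigr => x _; ring.
    rewrite sumrB -!mulr_sumr sum1 -(@mean_seq _ s)//; last by move=> x; rewrite snu.
    rewrite le_eqVlt; apply/orP; left; apply/eqP.
    have -> : mean nu = mu - d by rewrite /d; ring.
    by field.
  rewrite big_seq [leRHS]big_seq; apply: ler_sum => x /s01 x01; apply: ler_wpM2l => //.
  rewrite tE; apply: le_trans (ln_ge_quad _); last by nra.
  rewrite lerD2l lerN2 ler_pM2l// exprMn ler_piMr ?sqr_ge0//.
  by rewrite expr2; nra.
have [|l [nu' [_ _ [dnu' _] mnu' KLE]]] := @duality_attained R nu ((mu + 1) / 2) dnu; first lra.
have ub : (Kinf nu mu <= KL nu nu')%E.
  by apply: ereal_inf_lbound; exists nu' => //; split=> //; lra.
rewrite KLE in ub.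
move: lb ub; case: (Kinf nu mu) => [k|//|//].
rewrite !lee_fin => lb _; exists k => //; apply: lt_le_trans lb.
by rewrite divr_gt0// exprn_gt0//; lra.
Qed.

(** The dual witness has mean at least [m > mu], so it meets the strict constraint in [Kinf]. *)
Lemma Kinf_le_dual (R : realType) (nu : R -> R) (mu m : R) :
  is_fsdist nu -> 0 <= mu < m -> m < 1 ->
  exists l, [/\ 0 <= l <= 1, forall x, nu x != 0 -> 0 < tilt l m x &
    (Kinf nu mu <= (\sum_(x \in Supp nu) nu x * ln (tilt l m x))%:E)%E].
Proof.
move=> dnu mum m1.
have [|l [nu' [l01 W0 [dnu' _] mnu' KLE]]] := @duality_attained R nu m dnu; first lra.
exists l; split => //; rewrite -KLE.
by apply: ereal_inf_lbound; exists nu' => //; split=> //; lra.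
Qed.

(* Since [ln (tilt l m x)] is bounded above and has nonnegative expectation, it
   is bounded below on the support as soon as all atoms have mass at least [p];
   this makes the quadratic error term uniform in [l]. *)
Lemma tilt_mgf_le (R : realType) (nu : R -> R) (mu p k eps : R) :
  is_fsdist nu -> mu < 1 -> 0 < p -> (forall x, nu x != 0 -> p <= nu x) ->
  Kinf nu mu = k%:E -> 0 < eps -> 2 * eps <= mu -> 2 * eps <= 1 - mu ->
  2 * eps <= (1 - mu) * p -> 6 * eps <= k * (1 - mu) ->
  exists l, [/\ 0 <= l <= 1, forall x, nu x != 0 -> 0 < tilt l (mu - 2 * eps) x &
    \sum_(y \in Supp nu) nu y * expR (- (eps * ln (tilt l (mu - 2 * eps) y))) <=
    1 - eps * (k - (6 / (1 - mu) + 2 / ((1 - mu) * p) ^+ 2) * eps)].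
Proof.
move=> dnu mu1 p0 pnu Kk e0 emu e1mu ep ek.
have [s [us snu s01 sum1]] := fsdist_seq dnu.
have nu0 := dnu.1.
have [||l [l01 W2 hk]] := @Kinf_le_dual R nu mu (mu + eps) dnu; [lra|lra|].
set m1 := mu - 2 * eps; set m2 := mu + eps in W2 hk.
have r0 : 0 < (1 - m2) / (1 - m1) by rewrite divr_gt0; rewrite /m1 /m2; lra.
have W12 x : x \in s -> (1 - m2) / (1 - m1) * tilt l m2 x <= tilt l m1 x.
  by move=> /s01 x01; apply: tilt_monom => //; rewrite /m1 /m2; lra.
have W1 x : nu x != 0 -> 0 < tilt l m1 x.
  move=> nx; apply: lt_le_trans (W12 _ _); last by rewrite snu.
  by rewrite mulr_gt0// W2.
exists l; split => //.
rewrite (@Supp_sum _ s)//; last 2 first.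
- by move=> x; rewrite snu.
- by move=> x ->; rewrite mul0r.
pose v x := ln (tilt l m1 x); set Q := (1 - mu)^-1.
have Q0 : 0 < Q by rewrite invr_gt0; lra.
(* Passing from [mu + eps] to [mu - 2 * eps] costs at most [3 * eps / (1 - m2)], and [1 - m2] is at
   least half of [1 - mu]. *)
have lnr : - (6 * eps * Q) <= ln ((1 - m2) / (1 - m1)).
  have := @ln_le_subr1 R (((1 - m2) / (1 - m1))^-1); rewrite invr_gt0 lnV ?posrE// => /(_ r0).
  have : ((1 - m2) / (1 - m1))^-1 - 1 <= 6 * eps * Q.
    have -> : ((1 - m2) / (1 - m1))^-1 - 1 = 3 * eps / (1 - m2).
      by rewrite /m1 /m2; field; apply/andP; split; lra.
    rewrite ler_pdivrMr; last by rewrite /m2; lra.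
    have : 1 - mu <= 2 * (1 - m2) by rewrite /m2; lra.
    rewrite -(ler_pM2l Q0) mulVf; last lra.
    by move=> h; have : eps * 1 <= eps * (Q * (2 * (1 - m2))); [rewrite ler_pM2l|lra].
  lra.
have Ev : k - 6 * eps * Q <= \sum_(x <- s) nu x * v x.
  move: hk; rewrite Kk lee_fin (@Supp_sum _ s)//; last 2 first.
  - by move=> x; rewrite snu.
  - by move=> x ->; rewrite mul0r.
  move=> hk; rewrite -[X in X <= _](_ : k * 1 - 6 * eps * Q * 1 = _); last by ring.
  apply: (@le_trans _ _ (\sum_(x <- s) (nu x * ln (tilt l m2 x) - 6 * eps * Q * nu x))).
    by rewrite sumrB -mulr_sumr sum1; lra.
  rewrite big_seq [leRHS]big_seq; apply: ler_sum => x xs.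
  have nx : nu x != 0 by rewrite -snu.
  rewrite [6 * eps * Q * _]mulrC -mulrBr; apply: ler_wpM2l => //.
  have : ln ((1 - m2) / (1 - m1) * tilt l m2 x) <= v x.
    by rewrite /v ler_ln ?posrE; [exact: W12|rewrite mulr_gt0// W2|exact: W1].
  by rewrite lnM ?posrE ?W2//; lra.
have Ev0 : 0 <= \sum_(x <- s) nu x * v x.
  apply: le_trans Ev; rewrite subr_ge0 ler_pdivrMr//; lra.
have vQ x : x \in s -> v x <= Q.
  move=> xs; have x01 := s01 _ xs.
  have := ln_le_subr1 (W1 x _); rewrite -snu => /(_ xs).
  have : tilt l m1 x <= (1 - m1)^-1 by apply: tilt_le; rewrite /m1; lra.
  have : (1 - m1)^-1 <= Q by rewrite lef_pV2 ?posrE /m1; lra.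
  by rewrite /v; lra.
have vB x : x \in s -> p * `|v x| <= Q.
  move=> xs; have nx : p <= nu x by rewrite pnu// -snu.
  have nx1 : nu x <= 1.
    by rewrite -sum1 (bigD1_seq x)//= lerDl sumr_ge0.
  have [v0|v0] := leP 0 (v x); first by rewrite ?ger0_norm//; have := vQ _ xs; nra.
  rewrite ltr0_norm//.
  have : \sum_(y <- s | y != x) nu y * v y <= Q.
    apply: (@le_trans _ _ (\sum_(y <- s | y != x) nu y * Q)).
      rewrite big_seq_cond [leRHS]big_seq_cond; apply: ler_sum => y /andP[ys _].
      by apply: ler_wpM2l => //; exact: vQ.
    rewrite -mulr_suml -[leRHS]mul1r ler_wpM2r//; first exact: ltW.
    by rewrite -sum1 [leRHS](bigD1_seq x)//= lerDr.
  have := Ev0; rewrite (bigD1_seq x)//=; nra.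
have vB' x : x \in s -> `|v x| <= ((1 - mu) * p)^-1.
  move=> xs; have := vB _ xs; rewrite mulrC -ler_pdivlMr// => /le_trans; apply.
  by rewrite /Q le_eqVlt; apply/orP; left; apply/eqP; field; apply/andP; split; lra.
apply: (@le_trans _ _ (\sum_(x <- s) ((1 + 2 / ((1 - mu) * p) ^+ 2 * eps ^+ 2) * nu x
    - eps * (nu x * v x)))); last first.
  rewrite sumrB -!mulr_sumr sum1 mulr1.
  have : eps * (k - 6 * eps * Q) <= eps * \sum_(x <- s) nu x * v x by rewrite ler_pM2l.
  rewrite /Q; lra.
rewrite big_seq [leRHS]big_seq; apply: ler_sum => x xs.
have q0 : 0 < (1 - mu) * p by rewrite mulr_gt0//; lra.
have := vB' _ xs; rewrite -/(v x) => vx.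
have evx : `|- (eps * v x)| <= 1 / 2.
  rewrite normrN normrM gtr0_norm//.
  apply: (@le_trans _ _ (eps * ((1 - mu) * p)^-1)); first by rewrite ler_pM2l.
  rewrite ler_pdivrMr//; lra.
have := expR_le_quad evx.
have : (eps * v x) ^+ 2 <= eps ^+ 2 * ((1 - mu) * p)^-1 ^+ 2.
  rewrite exprMn ler_pM2l ?exprn_gt0// -real_normK ?num_real//.
  by apply: lerXn2r; rewrite ?nnegrE// invr_ge0 ltW.
rewrite -[X in _ <= X -> _]mulrC exprVn.
have -> : (1 + 2 / ((1 - mu) * p) ^+ 2 * eps ^+ 2) * nu x - eps * (nu x * v x) =
  nu x * (1 - eps * v x + 2 * (((1 - mu) * p) ^- 2 * eps ^+ 2)) by ring.
move=> h1 h2; apply: ler_wpM2l => //; rewrite sqrrN in h2; lra.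
Qed.

(** * Assembling the regret bound *)

Lemma ln_ge_half (R : realType) (x : R) : 2 <= x -> 1 / 2 <= ln x.
Proof.
move=> x2; have x0 : 0 < x by lra.
have := @ln_le_subr1 R x^-1; rewrite invr_gt0 lnV ?posrE// => /(_ x0).
have : x^-1 <= 1 / 2 by rewrite -[x^-1]mul1r ler_pdivrMr//; lra.
lra.
Qed.

Lemma f_klucbE (R : realType) (x : R) : 2 <= x -> f_klucb x = ln (x * ln x).
Proof. by move=> x2; rewrite /f_klucb lnM// posrE; [lra|have := ln_ge_half x2; lra]. Qed.

Lemma f_klucb_ge0 (R : realType) (x : R) : 2 <= x -> 0 <= f_klucb x.
Proof. by move=> x2; rewrite f_klucbE// ln_ge0//; have := ln_ge_half x2; nra. Qed.

Lemma f_klucb_le (R : realType) (x y : R) : 2 <= x -> x <= y -> f_klucb x <= f_klucb y.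
Proof.
move=> x2 xy; have := ln_ge_half x2 => lx.
have lxy : ln x <= ln y by rewrite ler_ln ?posrE; lra.
by rewrite /f_klucb lerD// ler_ln ?posrE//; lra.
Qed.

Lemma tilt_grid01 (R : realType) (mu eps : R) (n : nat) :
  0 < eps <= 1 -> 0 <= mu -> mu < 1 -> {in tilt_grid mu eps n, forall l, 0 <= l <= 1}.
Proof.
move=> e01 mu0 mu1 l; rewrite in_cons => /orP[/eqP ->|/mapP[i]].
  by apply/andP; split; nra.
rewrite mem_iota add0n ltnS /= => ni ->; rewrite divr_ge0//=.
have [->|n0] := posnP n; first by rewrite invr0 mulr0.
by rewrite ler_pdivrMr ?ltr0n// mul1r ler_nat.
Qed.

(** Log-tilts of [a] summing beyond [f_klucb T] exclude the initial rounds and keep its index below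
    or at [mu - 2 * eps]. The index of [b] is no larger, so the hypothesis of [le_UCB] fails at
    [mu - eps]. The offending [l] is rounded to the grid, and exponentiation turns [f_klucb t] into
    [t * ln t]. *)
Lemma klucb_pull_cover (R : realType) (K : nat) (nu : 'I_K -> R -> R) pol (a b : 'I_K)
    (T n : nat) (l mu eps : R) (h : seq ('I_K * R)) :
  (2 <= K)%N -> (forall c, is_fsdist (nu c)) -> mu < 1 ->
  is_empirical_klucb (@f_klucb R) pol ->
  0 < eps <= 1 -> 2 * eps <= mu -> 2 / (eps ^+ 2 * (1 - mu)) <= n%:R ->
  0 <= l <= 1 -> (forall x, nu a x != 0 -> 0 < tilt l (mu - 2 * eps) x) ->
  plausible nu h -> (size h < T)%N -> pol h = a ->
  f_klucb T%:R < \sum_(x <- rewards h a) ln (tilt l (mu - 2 * eps) x) ->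
  (2 <= T)%N -> (2 <= size h)%N /\
  (size h)%:R * ln (size h)%:R <= mixture_wealth (tilt_grid mu eps n) mu (rewards h b).
Proof.
move=> K2 dnu mu1 klucb e01 emu hn l01 W1 ph hT pa FS T2.
have T2' : 2 <= T%:R :> R by rewrite ler_nat.
have rw01 c : {in rewards h c, forall x, 0 <= x <= 1}.
  move=> x /(plausible_rewards ph); have [s [_ snu s01 _]] := fsdist_seq (dnu c).
  by rewrite -snu; exact: s01.
have [kl1 kl2] := klucb h.
have [hK|Kh] := ltnP (size h) K.
  have : rewards h a = [::] by apply: size0nil; rewrite size_rewards -pa kl1.
  by move=> r0; move: FS; rewrite r0 big_nil; have := f_klucb_ge0 T2'; lra.
have h2 : (2 <= size h)%N by exact: leq_trans K2 Kh.
split => //; set t := (size h)%:R : R.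
have t2 : 2 <= t by rewrite ler_nat.
have ft0 := f_klucb_ge0 t2.
have ftT : f_klucb t <= f_klucb T%:R by apply: f_klucb_le => //; rewrite ler_nat ltnW.
have Ua : (UCB (empdist h a) (f_klucb t / (Npulls h a)%:R) <= (mu - 2 * eps)%:E)%E.
  apply: (@UCB_le _ _ _ _ l) => //; [lra| |exact: le_lt_trans FS].
  by move=> x /(plausible_rewards ph); exact: W1.
have := kl2 Kh b; rewrite pa -/t => /le_trans /(_ Ua) Ub.
have [l0 [l01' W0 S0]] : exists l0, [/\ 0 <= l0 <= 1,
    {in rewards h b, forall x, 0 < tilt l0 (mu - eps) x} &
    f_klucb t < \sum_(x <- rewards h b) ln (tilt l0 (mu - eps) x)].
  apply: contrapT => no.
  have : ((mu - eps)%:E <= UCB (empdist h b) (f_klucb t / (Npulls h b)%:R))%E.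
    apply: le_UCB => //; first lra.
    move=> l0 l01' W0; rewrite leNgt; apply/negP => S0; apply: no.
    by exists l0; split.
  by move=> /le_trans /(_ Ub); rewrite lee_fin; lra.
have [||l' l'g [W' S']] := tilt_grid_dominates e01 _ mu1 l01' hn (rw01 b) W0; [lra|lra|].
have tl0 : 0 < t * ln t by have := ln_ge_half t2; nra.
have : t * ln t <= \prod_(x <- rewards h b) tilt l' mu x.
  rewrite -[leLHS](@lnK R) ?posrE// -f_klucbE//.
  apply: (@le_trans _ _ (expR (\sum_(x <- rewards h b) ln (tilt l' mu x)))).
    by rewrite ler_expR; lra.
  rewrite expR_sum le_eqVlt; apply/orP; left; apply/eqP.
  by apply: eq_big_seq => x xr; rewrite lnK// posrE W'.
have mu0 : 0 <= mu by lra.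
move/le_trans; apply; move: l'g (tilt_grid01 (n := n) e01 mu0 mu1).
rewrite /mixture_wealth; move: (tilt_grid mu eps n) => g l'g g01.
rewrite [leRHS](big_rem l')//= lerDl.
rewrite big_seq; apply: sumr_ge0 => l2 /mem_rem /g01 l201.
by rewrite big_seq; apply: prodr_ge0 => x /(rw01 b) x01; apply: tilt_ge0 => //; lra.
Qed.

(** For [y = x - 1], two uses of [ln r <= r - 1] give [1 / x <= ln x - ln y] and
    [1 / (x * ln x) <= ln (ln x) - ln (ln y)], which telescopes. The constant 2 covers the term
    [i = 2] and the negative [ln (ln 2)]. *)
Lemma sum_inv_nlogn_le (R : realType) (T : nat) : (3 <= T)%N ->
  \sum_(0 <= i < T | (2 <= i)%N) (i%:R * ln i%:R)^-1 <= 2 + ln (ln T%:R) :> R.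
Proof.
move=> T3.
suff h n : \sum_(0 <= i < n.+3 | (2 <= i)%N) (i%:R * ln i%:R)^-1 <= 2 + ln (ln n.+2%:R) :> R.
  rewrite -(subnK T3) addn3; apply: le_trans (h _) _; rewrite lerD2l.
  have h2 : 2 <= (T - 3).+2%:R :> R by rewrite ler_nat.
  have := ln_ge_half h2 => ?.
  have lle : ln (T - 3).+2%:R <= ln (T - 3).+3%:R :> R by rewrite ler_ln ?posrE ?ltr0n// ler_nat.
  by rewrite ler_ln ?posrE//; lra.
elim: n => [|n IH].
  rewrite !big_mkcond !big_nat_recr//= big_nil !add0r.
  have l2 := @ln_ge_half R 2 (lexx _).
  have l20 : 0 < ln 2 :> R by lra.
  have := @ln_le_subr1 R (ln 2)^-1; rewrite invr_gt0 lnV ?posrE// => /(_ l20).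
  have : (ln 2)^-1 <= 2 :> R by rewrite -[(ln 2)^-1]mul1r ler_pdivrMr//; lra.
  rewrite invfM; lra.
rewrite big_mkcond big_nat_recr//= -big_mkcond /=.
apply: le_trans (lerD IH (lexx _)) _; rewrite -addrA lerD2l.
set x : R := n.+3%:R; set y : R := n.+2%:R.
have xy : x = y + 1 by rewrite /x /y natr1.
have y2 : 2 <= y by rewrite ler_nat.
clearbody x y; have ly := ln_ge_half y2.
have lx : ln y < ln x by rewrite ltr_ln ?posrE; lra.
have h1 : x^-1 <= ln x - ln y.
  have := @ln_le_subr1 R (y / x); rewrite ln_div ?posrE; [|lra|lra].
  have -> : y / x - 1 = - x^-1 by rewrite xy; field; lra.
  rewrite divr_gt0; [|lra|lra]; move=> /(_ isT); lra.
have := @ln_le_subr1 R (ln y / ln x); rewrite ln_div ?posrE; [|lra|lra].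
rewrite divr_gt0; [|lra|lra]; move=> /(_ isT).
have : (x * ln x)^-1 <= (ln x - ln y) / ln x.
  by rewrite invfM ler_pM2r// invr_gt0; lra.
have -> : (ln x - ln y) / ln x = 1 - ln y / ln x by field; lra.
lra.
Qed.

(** The maximum has default 0, so a nonzero value must come from an arm. *)
Lemma mustar_attained (R : realType) (K : nat) (nu : 'I_K -> R -> R) :
  mustar nu != 0 -> exists b, mean (nu b) = mustar nu.
Proof.
rewrite /mustar; apply: (@big_ind _ (fun x => x != 0 -> exists b, mean (nu b) = x)) => //.
- by rewrite eqxx.
- by move=> x y; rewrite /Num.max; case: ifP.
- by move=> b _ _; exists b.
Qed.

Lemma exists_pos_lower_bound (R : realType) (s : seq R) :
  {in s, forall x, 0 < x} -> exists2 c, 0 < c & {in s, forall x, c <= x}.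
Proof.
elim: s => [|x t IH] st; first by exists 1.
have [|c c0 hc] := IH; first by move=> y yt; apply: st; rewrite inE yt orbT.
exists (Num.min c x); first by rewrite lt_min c0 st// inE eqxx.
by move=> y; rewrite inE ge_min => /orP[/eqP ->|/hc ->//]; rewrite lexx orbT.
Qed.

Lemma fsdist_min_mass (R : realType) (nu : R -> R) : is_fsdist nu ->
  exists2 p, 0 < p & forall x, nu x != 0 -> p <= nu x.
Proof.
move=> dnu; have [s [_ snu _ _]] := fsdist_seq dnu.
have [|p p0 hp] := @exists_pos_lower_bound R (map nu s).
  by move=> _ /mapP[x xs ->]; rewrite lt_def dnu.1 andbT -snu.
by exists p => // x nx; apply: hp; rewrite map_f// snu.
Qed.

(** [C] is fixed before the other arms, the policy and [T]. With [z] the fifth root of [ln T] and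
    [eps = c / z], every error term is at most a multiple of [z ^ 4]. *)
Lemma ENpulls_le_asymptotic (R : realType) (nua : R -> R) (mu : R) :
  is_fsdist nua -> mean nua < mu -> 0 < mu < 1 ->
  exists2 C, 0 < C & forall (K : nat) (nu : 'I_K -> R -> R) pol (a b : 'I_K) (T : nat),
    (2 <= K)%N -> (forall c, is_fsdist (nu c)) -> mean (nu b) = mu ->
    is_empirical_klucb (@f_klucb R) pol -> nu a = nua -> (3 <= T)%N ->
    ENpulls nu pol a T <= f_klucb T%:R / fine (Kinf nua mu) + C * ln T%:R `^ (4 / 5).
Proof.
move=> dnua mmu mu01.
have [k Kk k0] : exists2 k, Kinf nua mu = k%:E & 0 < k by apply: Kinf_fin_gt0 => //; lra.
have [p p0 pnu] := fsdist_min_mass dnua.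
rewrite Kk /=.
(* Loss of drift per unit of [eps] in [tilt_mgf_le]. *)
set C1 := 6 / (1 - mu) + 2 / ((1 - mu) * p) ^+ 2.
have q0 : 0 < 1 - mu by lra.
have C10 : 0 < C1 by rewrite addr_gt0// divr_gt0// ?exprn_gt0// mulr_gt0.
(* The last entry keeps the drift [k - C1 * eps] at least [k / 2]; the others are the smallness
   conditions on [eps <= c]. *)
have [|c c0 hc] := @exists_pos_lower_bound R [:: 1; mu / 2; (1 - mu) / 2;
    (1 - mu) * p / 2; k * (1 - mu) / 6; k / (2 * C1)].
  move=> x; rewrite !inE.
  have h1 : 0 < (1 - mu) * p by rewrite mulr_gt0.
  have h2 : 0 < k * (1 - mu) by rewrite mulr_gt0.
  have h3 : 0 < k / (2 * C1) by rewrite divr_gt0// mulr_gt0.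
  by move=> /or4P[/eqP ->|/eqP ->|/eqP ->|/or3P[/eqP ->|/eqP ->|/eqP ->]]; lra.
have {hc} [[c1 cmu c1mu cp ck] cC] : [/\ c <= 1, 2 * c <= mu, 2 * c <= 1 - mu,
    2 * c <= (1 - mu) * p & 6 * c <= k * (1 - mu)] /\ 2 * (C1 * c) <= k.
  have h x : x \in [:: 1; mu / 2; (1 - mu) / 2; (1 - mu) * p / 2;
    k * (1 - mu) / 6; k / (2 * C1)] -> c <= x by exact: hc.
  split; last first.
    have : c <= k / (2 * C1) by apply: h; rewrite !inE eqxx !orbT.
    by rewrite ler_pdivlMr ?mulr_gt0//; lra.
  have := h 1; have := h (mu / 2); have := h ((1 - mu) / 2).
  have := h ((1 - mu) * p / 2); have := h (k * (1 - mu) / 6).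
  rewrite !inE !eqxx !orbT => /(_ isT) h1 /(_ isT) h2 /(_ isT) h3 /(_ isT) h4 /(_ isT) h5.
  by split; lra.
(* [G * z ^ 2] bounds the grid size [n + 2], where [n] itself is rounded up by at most 1. *)
set G := 2 / (c ^+ 2 * (1 - mu)) + 3.
have G0 : 3 <= G by rewrite lerDr divr_ge0// mulr_ge0 ?exprn_ge0 ?ltW.
(* The summands come in turn from [A1], the rounding of [n0], [A2] and [A3]; the 7 stems from
   [2 + ln (ln T) <= 2 + 5 * z]. *)
set C := 4 * C1 * c / k ^+ 2 + 1 + 2 / (c * k) + 7 * G.
exists C.
  have : 0 < 4 * C1 * c / k ^+ 2 by rewrite divr_gt0 ?exprn_gt0// !mulr_gt0.
  have : 0 < 2 / (c * k) by rewrite divr_gt0// mulr_gt0.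
  by rewrite /C; lra.
move=> K nu pol a b T K2 dnu mb klucb nuaE T3.
have T2 : (2 <= T)%N by exact: ltnW.
have T3' : 3 <= T%:R :> R by rewrite ler_nat.
have FE : f_klucb T%:R = ln T%:R + ln (ln T%:R) :> R by [].
have L1 : 1 <= ln T%:R :> R.
  by apply: le_trans (ln3_ge1 R) _; rewrite ler_ln ?posrE//; lra.
have sumT := sum_inv_nlogn_le R T3.
have [z z1 [zL zL4]] : exists2 z : R, 1 <= z & z ^+ 5 = ln T%:R /\ z ^+ 4 = ln T%:R `^ (4 / 5).
  exists (ln T%:R `^ (1 / 5)); last first.
    split; rewrite -powR_mulrn ?powR_ge0// -powRrM; last by congr powR; field.
    by rewrite (_ : 1 / 5 * 5%:R = 1) ?powRr1//; [lra|field].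
  rewrite /powR gt_eqF; last lra.
  by apply: le_trans (expR_ge1Dx _); rewrite lerDl mulr_ge0// ln_ge0.
rewrite -zL4.
have z0 : 0 < z by lra.
have lnL : ln (ln T%:R) <= 5 * z :> R.
  by rewrite -zL lnXn// -mulr_natl; have := ln_le_subr1 z0; lra.
have lnL2 : ln (ln T%:R) <= ln T%:R :> R.
  by have := @ln_le_subr1 R (ln T%:R); rewrite (lt_le_trans _ L1)// => /(_ isT); lra.
have F0 : 0 <= f_klucb T%:R :> R by apply: f_klucb_ge0; lra.
move: (f_klucb T%:R) FE F0 => F FE F0.
have F2L : F <= 2 * z ^+ 5 by rewrite zL; lra.
set eps := c / z.
have eps0 : 0 < eps by rewrite divr_gt0.
have epsc : eps <= c by rewrite ler_pdivrMr// ler_peMr// ltW.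
have D2 : 2 * (C1 * eps) <= k.
  by apply: le_trans cC; rewrite ler_pM2l// ler_pM2l.
set kp := k - C1 * eps.
have kp0 : k <= 2 * kp by rewrite /kp; lra.
set rho := 1 - eps * kp.
set n := (Num.truncn (2 / (eps ^+ 2 * (1 - mu)))).+1.
(* About the time at which a walk of drift [kp] passes [F]: then [rho ^ n0] cancels
   [expR (eps * F)]. *)
set n0 := (Num.truncn (F / kp)).+1.
have [nX Xn] : 2 / (eps ^+ 2 * (1 - mu)) <= n%:R /\
    n%:R <= 2 / (eps ^+ 2 * (1 - mu)) + 1.
  have /truncn_itv/andP[t1 t2] : 0 <= 2 / (eps ^+ 2 * (1 - mu)).
    by rewrite divr_ge0// mulr_ge0 ?exprn_ge0 ?ltW.
  by split; [exact: ltW t2|rewrite /n -natr1; lra].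
have [n0X Xn0] : F / kp <= n0%:R /\ n0%:R <= F / kp + 1.
  have /truncn_itv/andP[t1 t2] : 0 <= F / kp by rewrite divr_ge0//; lra.
  by split; [exact: ltW t2|rewrite /n0 -natr1; lra].
clearbody n n0.
have [l [l01 W1 mgf]] : exists l, [/\ 0 <= l <= 1,
    forall x, nua x != 0 -> 0 < tilt l (mu - 2 * eps) x &
    \sum_(y \in Supp nua) nua y * expR (- (eps * ln (tilt l (mu - 2 * eps) y))) <= rho].
  by apply: (@tilt_mgf_le R nua mu p k eps) => //; lra.
have rho0 : 0 <= rho.
  apply: le_trans mgf; apply: fsumr_ge0 => x _.
  by rewrite mulr_ge0 ?expR_ge0//; exact: dnua.1.
have rho1 : rho < 1 by rewrite /rho ltrBlDr ltrDl mulr_gt0//; lra.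
have cover h : plausible nu h -> (size h < T)%N -> pol h = a ->
    F < \sum_(x <- rewards h a) ln (tilt l (mu - 2 * eps) x) -> (2 <= size h)%N /\
    (size h)%:R * ln (size h)%:R <=
      mixture_wealth (tilt_grid mu eps n) (mean (nu b)) (rewards h b).
  move=> ph hT pa FS.
  rewrite FE in FS; rewrite mb.
  by apply: (@klucb_pull_cover R K nu pol a b T n l mu eps h) => //; rewrite ?nuaE//; lra.
have mb1 : mean (nu b) < 1 by rewrite mb; lra.
have g01 : {in tilt_grid mu eps n, forall l, 0 <= l <= 1}.
  by apply: tilt_grid01; lra.
have rho01 : 0 <= rho < 1 by rewrite rho0.
have := @ENpulls_le R K nu pol a b T n0 (tilt_grid mu eps n)
  (fun x => ln (tilt l (mu - 2 * eps) x)) F eps rho dnu mb1 g01 rho01 (ltW eps0).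
rewrite nuaE => /(_ mgf cover) /le_trans; apply.
have z4 : 1 <= z ^+ 4 by rewrite exprn_ege1.
have A1 : F / kp <= F / k + 4 * C1 * c / k ^+ 2 * z ^+ 4.
  apply: (@le_trans _ _ (F / k + F * (2 * (C1 * eps) / k ^+ 2))).
    rewrite -mulrDr; apply: ler_wpM2l => //.
    rewrite -[kp^-1]mul1r ler_pdivrMr; last lra.
    have -> : (k^-1 + 2 * (C1 * eps) / k ^+ 2) * kp =
        1 + (C1 * eps) * (k - 2 * (C1 * eps)) / k ^+ 2 by rewrite /kp; field; lra.
    rewrite lerDl; apply: divr_ge0; last by rewrite exprn_ge0 ?ltW.
    by apply: mulr_ge0; [rewrite mulr_ge0 ?ltW|lra].
  rewrite lerD2l.
  have -> : 4 * C1 * c / k ^+ 2 * z ^+ 4 = 2 * z ^+ 5 * (2 * (C1 * eps) / k ^+ 2).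
    by rewrite /eps; field; rewrite ?gt_eqF//; lra.
  apply: ler_wpM2r => //; apply: divr_ge0; last exact: sqr_ge0.
  by have : 0 <= C1 * eps; [rewrite mulr_ge0 ?ltW|lra].
have A2 : expR (eps * F) * rho ^+ n0 / (1 - rho) <= 2 / (c * k) * z ^+ 4.
  have ek0 : 0 < eps * kp by rewrite mulr_gt0//; lra.
  have -> : 1 - rho = eps * kp by rewrite /rho; ring.
  have h : expR (eps * F) * rho ^+ n0 <= 1.
    have : rho ^+ n0 <= expR (- (eps * kp)) ^+ n0.
      by apply: lerXn2r; rewrite ?nnegrE ?expR_ge0//; exact: expR_ge1Dx.
    rewrite -expRM_natl => h; apply: le_trans (ler_wpM2l (expR_ge0 _) h) _.
    rewrite -expRD expR_le1 mulrN subr_le0.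
    have : eps * F <= eps * (n0%:R * kp) by rewrite ler_pM2l// -ler_pdivrMr//; lra.
    by rewrite mulrCA.
  apply: (@le_trans _ _ ((eps * kp)^-1)).
    by rewrite ler_piMl// invr_ge0 ltW.
  apply: (@le_trans _ _ (2 / (c * k) * z)); last first.
    apply: ler_wpM2l; first by rewrite divr_ge0// mulr_ge0 ?ltW.
    by rewrite exprS ler_peMr ?exprn_ege1// ltW.
  rewrite -[leLHS]mul1r ler_pdivrMr//.
  have -> : 2 / (c * k) * z * (eps * kp) = 2 * kp / k.
    by rewrite /eps; field; rewrite ?gt_eqF//; lra.
  by rewrite ler_pdivlMr// mul1r.
have A3 : (size (tilt_grid mu eps n))%:R *
    \sum_(0 <= i < T | (2 <= i)%N) (i%:R * ln i%:R)^-1 <= 7 * G * z ^+ 4.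
  have -> : 7 * G * z ^+ 4 = (G * z ^+ 2) * (7 * z ^+ 2) by ring.
  have z2 : z <= z ^+ 2 by rewrite expr2 ler_peMr// ltW.
  apply: ler_pM => //.
  - by apply: sumr_ge0 => i i2; rewrite invr_ge0 mulr_ge0// ln_ge0// ler1n ltnW.
  - rewrite /tilt_grid /= size_map size_iota -!natr1.
    have e : 2 / (eps ^+ 2 * (1 - mu)) = 2 / (c ^+ 2 * (1 - mu)) * z ^+ 2.
      by rewrite /eps; field; rewrite ?gt_eqF//; lra.
    rewrite /G [leRHS]mulrDl.
    have : 1 <= z ^+ 2 by lra.
    rewrite e in Xn; lra.
  - by apply: le_trans sumT _; lra.
have -> : C * z ^+ 4 = 4 * C1 * c / k ^+ 2 * z ^+ 4 + z ^+ 4 + 2 / (c * k) * z ^+ 4 + 7 * G * z ^+ 4.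
  by rewrite /C; ring.
lra.
Qed.

Theorem theorem2 (R : realType) :
  exists M : (R -> R) -> R -> R,
    (forall (nu : R -> R) (mu : R), 0 < M nu mu) /\
    forall (K : nat) (nu : 'I_K -> R -> R) (pol : seq ('I_K * R) -> 'I_K)
           (a : 'I_K) (T : nat),
      (2 <= K)%N ->
      (forall b, is_fsdist (nu b)) ->
      (forall b, 0 < mean (nu b)) ->
      mustar nu < 1 ->
      is_empirical_klucb (@f_klucb R) pol ->
      mean (nu a) < mustar nu ->
      (3 <= T)%N ->
      let ms := mustar nu in
      let k := fine (Kinf (nu a) ms) in
      let L := ln (T%:R : R) in
      ENpulls nu pol a T <=
        L / k
        + 36 / ms ^+ 4 * (L `^ (4 / 5)) * ln L
        + (72 / ms ^+ 4 + 2 * ms / ((1 - ms) * k ^+ 2)) * (L `^ (4 / 5))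
        + (1 - ms) ^+ 2 * M (nu a) ms / (2 * ms ^+ 2) * (L `^ (2 / 5))
        + ln L / k
        + 2 * ms / ((1 - ms) * k ^+ 2)
        + 4.
Proof.
(* Choice over pairs makes [M] a function of the arm distribution and the best mean alone. The
   summands dropped from the bound are nonnegative. *)
suff /choice[M hM] : forall q : (R -> R) * R, exists M, 0 < M /\
    forall (K : nat) (nu : 'I_K -> R -> R) pol (a : 'I_K) (T : nat),
      (2 <= K)%N -> (forall b, is_fsdist (nu b)) -> (forall b, 0 < mean (nu b)) ->
      mustar nu < 1 -> is_empirical_klucb (@f_klucb R) pol ->
      mean (nu a) < mustar nu -> (3 <= T)%N -> nu a = q.1 -> mustar nu = q.2 ->
      ENpulls nu pol a T <= f_klucb T%:R / fine (Kinf q.1 q.2) +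
        36 / q.2 ^+ 4 * ln T%:R `^ (4 / 5) * ln (ln T%:R) +
        (1 - q.2) ^+ 2 * M / (2 * q.2 ^+ 2) * ln T%:R `^ (2 / 5).
  exists (fun nu mu => M (nu, mu)); split; first by move=> nu mu; exact: (hM (nu, mu)).1.
  move=> K nu pol a T K2 dnu mu0 ms1 klucb ma T3 /=.
  set ms := mustar nu; set k := fine (Kinf (nu a) ms); set L := ln T%:R.
  have := (hM (nu a, ms)).2 K nu pol a T K2 dnu mu0 ms1 klucb ma T3 erefl erefl.
  rewrite /= -/k -/L /f_klucb -/L mulrDl.
  have ms0 : 0 < ms by exact: lt_trans (mu0 a) ma.
  have L0 : 0 <= L `^ (4 / 5) by exact: powR_ge0.
  have h1 : 0 <= 2 * ms / ((1 - ms) * k ^+ 2).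
    apply: divr_ge0; first by rewrite mulr_ge0 ?ltW.
    by apply: mulr_ge0; [rewrite subr_ge0 ltW|exact: sqr_ge0].
  have h2 : 0 <= 72 / ms ^+ 4 by rewrite divr_ge0 ?exprn_ge0 ?ltW.
  have := mulr_ge0 (addr_ge0 h2 h1) L0; lra.
move=> [nua mu] /=.
have [[dnua mmu mu01]|no] :=
  pselect [/\ is_fsdist nua, mean nua < mu & 0 < mu < 1]; last first.
  (* Other pairs never arise under the hypotheses, so any positive value will do. *)
  exists 1; split => // K nu pol a T K2 dnu mu0 ms1 _ ma _ aE msE; case: no.
  by rewrite -aE -msE; split => //; rewrite ms1 andbT; exact: lt_trans (mu0 a) ma.
have [C C0 hC] := ENpulls_le_asymptotic dnua mmu mu01.
have e4 : 0 < mu ^+ 4 by rewrite exprn_gt0//; lra.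
have e2 : 0 < mu ^+ 2 by rewrite exprn_gt0//; lra.
have f2 : 0 < (1 - mu) ^+ 2 by rewrite exprn_gt0//; lra.
(* Where [36 / mu ^ 4 * ln L] does not yet exceed [C], [L] is bounded. *)
pose E := expR (2 / 5 * (C * mu ^+ 4 / 36)).
have E0 : 0 < E by exact: expR_gt0.
(* This [M] cancels the prefactor and leaves the coefficient [C * E]; in the bounded range [E]
   dominates the power 2/5 of [L]. *)
exists (C * E * (2 * mu ^+ 2) / (1 - mu) ^+ 2); split.
  by apply: divr_gt0 => //; apply: mulr_gt0; [exact: mulr_gt0|lra].
move=> K nu pol a T K2 dnu mu0 ms1 klucb ma T3 aE msE.
have [b mb] : exists b, mean (nu b) = mustar nu.
  by apply: mustar_attained; rewrite gt_eqF// msE; lra.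
have := hC K nu pol a b T K2 dnu _ klucb aE T3; rewrite mb => /(_ msE).
move/le_trans; apply; rewrite -addrA lerD2l.
have -> : (1 - mu) ^+ 2 * (C * E * (2 * mu ^+ 2) / (1 - mu) ^+ 2) / (2 * mu ^+ 2) = C * E.
  by field; rewrite ?gt_eqF//; lra.
have L1 : 1 <= ln T%:R :> R.
  by apply: le_trans (ln3_ge1 R) _; rewrite ler_ln ?posrE ?ltr0n ?ler_nat// ltnW// ltnW.
move: (ln T%:R) L1 => L L1.
have L0 : 0 < L by lra.
have [lnL|lnL] := leP (C * mu ^+ 4 / 36) (ln L).
  have : C * L `^ (4 / 5) <= 36 / mu ^+ 4 * L `^ (4 / 5) * ln L.
    rewrite mulrAC; apply: ler_wpM2r; first exact: powR_ge0.
    by move: lnL; rewrite ler_pdivrMr// -ler_pdivlMr//; lra.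
  have : 0 <= C * E * L `^ (2 / 5).
    by apply: mulr_ge0; [exact/ltW/mulr_gt0|exact: powR_ge0].
  lra.
have : 0 <= 36 / mu ^+ 4 * L `^ (4 / 5) * ln L.
  apply: mulr_ge0; last exact: ln_ge0.
  by apply: mulr_ge0; [rewrite divr_ge0 ?ltW|exact: powR_ge0].
have : C * L `^ (4 / 5) <= C * E * L `^ (2 / 5).
  have -> : 4 / 5 = 2 / 5 + 2 / 5 :> R by field.
  rewrite powRD; last by rewrite gt_eqF//; apply/implyP.
  rewrite -mulrA ler_pM2l//; apply: ler_wpM2r; first exact: powR_ge0.
  by rewrite /E /powR gt_eqF// ler_expR ler_pM2l ?ltW.
lra.
Qed.
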